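(* Let $k\ge 2$ and $1\le n_1\le\cdots\le n_k$ be integers, let $R\subseteq[n_1]$ be a non-empty set of integers, and let $\mathscr{F}\subseteq\mathcal{K}_R(n_1,\ldots,n_k)$ be an intersecting family. Then \[ |\mathscr{F}|\le\sum_{r\in R}\frac{(n_1-1)_{r-1}\cdots(n_k-1)_{r-1}}{(r-1)!}. \] Furthermore, equality is attained if and only if $\mathscr{F}$ is a star of $\mathcal{K}_R(n_1,\ldots,n_k)$.
   Context: For a positive integer $n$, $[n]=\{1,\ldots,n\}$. For non-negative integers $b\le a$, $(a)_b=\frac{a!}{(a-b)!}$. $\mathcal{K}(n_1,\ldots,n_k)$ denotes the complete $k$-partite $k$-graph with parts $[n_1],\ldots,[n_k]$ (regarded as disjoint); its edges are identified with the $k$-tuples $(x_1,\ldots,x_k)\in[n_1]\times\cdots\times[n_k]$. An $r$-matching is a set of $r$ pairwise vertex-disjoint edges, i.e. a set of $r$ such $k$-tuples any two of which differ in every coordinate. $\mathcal{K}_r(n_1,\ldots,n_k)$ is the set of all $r$-matchings of $\mathcal{K}(n_1,\ldots,n_k)$, and $\mathcal{K}_R(n_1,\ldots,n_k)=\bigcup_{r\in R}\mathcal{K}_r(n_1,\ldots,n_k)$. A family $\mathscr{F}\subseteq\mathcal{K}_R(n_1,\ldots,n_k)$ is intersecting if every pair of members of $\mathscr{F}$ share a common edge. A star of $\mathcal{K}_R(n_1,\ldots,n_k)$ is a family of the form $\{M\in\mathcal{K}_R(n_1,\ldots,n_k): e\in M\}$ for some edge $e$ of $\mathcal{K}(n_1,\ldots,n_k)$.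 *)

(* Defs.v *)
From HB Require Import structures.
From mathcomp Require Import all_boot all_order all_algebra.
From mathcomp Require Import finmap.

Set Implicit Arguments.
Unset Strict Implicit.
Unset Printing Implicit Defensive.

Section CompletePartite.
Variables (k : nat) (n : 'I_k -> nat).

(* The edges of K(n_1, ..., n_k): k-tuples whose i-th entry lies in [n_i],
   represented by the n_i-element type 'I_(n i).  Parts are numbered from 0,
   and taking an entry together with its index i makes the parts disjoint. *)
Definition edge : predArgType := {dffun forall i : 'I_k, 'I_(n i)}.
HB.instance Definition _ := Finite.on edge.

Definition vdisjoint (e f : edge) : bool := [forall i : 'I_k, e i != f i].

Definition is_matching (M : {set edge}) : bool :=
  [forall e in M, forall f in M, (e != f) ==> vdisjoint e f].

Definition Kr (r : nat) : {set {set edge}} :=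
  [set M : {set edge} | is_matching M & #|M| == r].

Definition KR (R : {fset nat}) : {set {set edge}} :=
  (\bigcup_(r <- R) Kr r)%SET.

Definition intersecting (F : {set {set edge}}) : Prop :=
  forall M N : {set edge}, M \in F -> N \in F ->
    exists e : edge, e \in M /\ e \in N.

Definition star (R : {fset nat}) (e : edge) : {set {set edge}} :=
  [set M in KR R | e \in M].

Definition is_star (R : {fset nat}) (F : {set {set edge}}) : Prop :=
  exists e : edge, F = star R e.

End CompletePartite.

Definition first_part (k : nat) (hk : 2 <= k) : 'I_k := Ordinal (ltnW hk).

(* Main.v *)
(** Matchings of size [r] are treated one size at a time, and by induction on the
    number of parts. Split the edges as a product of the edges [E] of the first
    [k - 1] parts and the last part [B]. The traces on [E] of an intersecting family
    form an intersecting family, and the members with a given trace are injections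
    into [B], i.e. (after extension) an intersecting family of permutations of [B];
    so the bounds multiply. When equality holds, every fibre is a full star, and
    two stars of fibres with distinct centres contain disjoint matchings as soon
    as [r > 2].

    For permutations the bound comes from Latin squares, which contain at most one
    member each. In the extremal case they contain exactly one, so if [g], [h] are
    disjoint rows which agree, as a set of values, on two columns, exchanging the two
    columns does not change the number of rows in the family (complete by Hall's
    theorem). This allows one to move a member off any edge which it does not share
    with another member [p], one edge at a time, so that the common edges of any
    number of members never run out.

    What remains is two parts of sizes [m <= n] and [r < m]. Here Katona's cycle method
    is applied to a cyclic order of all [m * n] edges in which any [r] consecutive
    ones are disjoint. In the extremal case the windows in the family are those
    through one position, and this position is not affected by transposing two
    non-adjacent columns; if some member missed the edge at this position, such
    transpositions would make a window disjoint from it. *)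

Require Import Defs.
From mathcomp Require Import all_boot all_order all_algebra all_fingroup.
From mathcomp Require Import finmap.
From mathcomp Require Import zify.

Set Implicit Arguments.
Unset Strict Implicit.
Unset Printing Implicit Defensive.

(** * Latin squares and intersecting families of permutations *)

(** Induction on the size of [S]: a non-empty proper subset with no spare neighbour is matched
    first, and the rest outside its neighbourhood; if there is none, any single pair may be fixed.
    The set [U] of available values is explicit so that the induction can shrink it. *)
Lemma hall_marriage (A B : finType) (b0 : B) (R : A -> {set B}) (S : {set A})
    (U : {set B}) :
  (forall X : {set A}, X \subset S ->
     #|X| <= #|(\bigcup_(x in X) R x) :&: U|) ->
  exists2 f : A -> B, {in S, forall x, f x \in R x :&: U} & {in S &, injective f}.
Proof.
have [n] := ubnP #|S|; elim: n => // n IHn in S U *; rewrite ltnS => leS hallS.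
pose N (X : {set A}) := (\bigcup_(x in X) R x) :&: U.
have [[X [XS Xn0 XnS cX]]|noX] : (exists X : {set A},
    [/\ X \subset S, X != set0, X != S & #|X| = #|N X|]) \/
    (forall X : {set A}, X \subset S -> X != set0 -> X != S -> #|X| != #|N X|).
  have [/existsP[X /and4P[XS Xn0 XnS /eqP cX]]|noX] := boolP [exists X : {set A},
      [&& X \subset S, X != set0, X != S & #|X| == #|N X|]].
    by left; exists X.
  right=> X XS Xn0 XnS; apply/negP=> cX; case/existsP: noX.
  by exists X; rewrite XS Xn0 XnS.
  have propX : X \proper S by rewrite properEneq XnS.
  have [||f fR finj] := IHn X U; first exact: leq_trans (proper_card propX) leS.
    by move=> Y YX; apply: hallS; apply: subset_trans XS.
  have [||g gR ginj] := IHn (S :\: X) (U :\: N X).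
  - apply: leq_trans leS; have := cardsID X S; rewrite (setIidPr XS).
    by move=> <-; rewrite -[ltnLHS]add0n ltn_add2r card_gt0.
  - move=> Y /subsetDP[YS disYX].
    (* The condition for [Y] is that for [X :|: Y], less the [#|X| = #|N X|] neighbours used up by
       [X]. *)
    have /hallS : X :|: Y \subset S by rewrite subUset XS.
    rewrite cardsU setIC disjoint_setI0 // cards0 subn0 bigcup_setU setIUl -/(N X).
    set V := _ :&: U; set W := _ :&: (_ :\: _).
    suff -> : N X :|: V = N X :|: W.
      by have := (leq_card_setU (N X) W).1; rewrite cX; lia.
    by apply/setP=> y; rewrite /V /W !inE; case: (y \in _); case: (_ \in U);
      rewrite ?andbF ?andbT ?orbF.
  exists (fun x => if x \in X then f x else g x).
    move=> x xS; case: ifPn => xX; first exact: fR.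
    by have := gR x; rewrite !inE xX xS => /(_ isT)/and3P[-> _ ->].
  move=> x y xS yS.
  have fg u v : u \in X -> v \in S -> v \notin X -> f u <> g v.
    move=> uX vS vX fgE; have := gR v; rewrite inE vX vS => /(_ isT).
    rewrite -fgE !inE => /and3P[_ /negP nfu _]; apply: nfu; have := fR u uX.
    rewrite inE => /andP[fuR ->]; rewrite andbT.
    by apply/bigcupP; exists u.
  case: ifPn => xX; case: ifPn => yX //.
  - exact: finj.
  - by move/(fg _ _ xX yS yX).
  - by move/esym/(fg _ _ yX xS xX).
  - by apply: ginj; rewrite inE ?xX ?yX.
have [->|[x xS]] := set_0Vmem S.
  by exists (fun=> b0) => x; rewrite inE.
have [y yR] : exists y, y \in R x :&: U.
  apply/set0Pn; rewrite -card_gt0; have := hallS [set x].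
  by rewrite big_set1 sub1set xS cards1 => ->.
have [||f fR finj] := IHn (S :\ x) (U :\ y).
- by move: leS; rewrite (cardsD1 x) xS.
- move=> Y YSx; have YS : Y \subset S by apply: subset_trans YSx (subD1set _ _).
  have [->|Yn0] := eqVneq Y set0; first by rewrite cards0.
  have YnS : Y != S.
    by apply/eqP=> YE; move: (subsetP YSx x); rewrite YE xS !inE eqxx => /(_ isT).
  have := hallS Y YS; rewrite leq_eqVlt => /orP[tY|].
    by have := noX Y YS Yn0 YnS; rewrite tY.
  rewrite (cardsD1 y (_ :&: U)); set u := (y \in _); set V := _ :\ _.
  suff -> : V = \bigcup_(x0 in Y) R x0 :&: (U :\ y) by case: u; lia.
  by apply/setP=> z; rewrite !inE andbCA.
move: yR; rewrite inE => /andP[yR yU].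
exists (fun z => if z == x then y else f z).
  move=> z zS; case: eqP => [->|/eqP zx]; first by rewrite inE yR yU.
  by have := fR z; rewrite !inE zx zS => /(_ isT)/and3P[-> _ ->].
have fy z : z \in S -> z != x -> f z <> y.
  by move=> zS zx fzy; have := fR z; rewrite !inE zx zS fzy eqxx andbF => /(_ isT).
move=> u v uS vS; case: eqP => [->|/eqP ux]; case: eqP => [->|/eqP vx] //.
- by move/esym/fy => /(_ vS vx).
- by move/fy => /(_ uS ux).
- by apply: finj; rewrite inE ?uS ?vS inE ?ux ?vx.
Qed.

(** Double counting: the [#|X| * d] pairs leaving [X] end in its neighbourhood, where each point
    receives at most [d]. This is Hall's condition. *)
Lemma regular_perfect_matching (T : finType) (R : rel T) (d : nat) :
  0 < d -> (forall x, #|[set y | R x y]| = d) ->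
  (forall y, #|[set x | R x y]| = d) ->
  exists g : {perm T}, forall x, R x (g x).
Proof.
move=> d_gt0 rowR colR.
have [t0|t0] := pickP T; last by exists 1%g => x; have := t0 x.
have [X _|f fR finj] := @hall_marriage T T t0 (fun x => [set y | R x y]) setT setT.
  set Y := _ :&: _; rewrite -(leq_pmul2r d_gt0).
  have -> : #|X| * d = \sum_(x in X) \sum_(y in Y) R x y.
    rewrite -sum_nat_const; apply: eq_bigr => x xX; rewrite -(rowR x) -sum1_card.
    rewrite [RHS]big_mkcond /= big_mkcond /=; apply: eq_bigr => y _; rewrite !inE andbT.
    case Rxy: (R x y); last by case: ifP.
    by rewrite ifT //; apply/bigcupP; exists x; rewrite ?inE.
  rewrite exchange_big /= -sum_nat_const; apply: leq_sum => y _.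
  rewrite -(colR y) -sum1_card big_mkcond [leqRHS]big_mkcond /=.
  by apply: leq_sum => x _; rewrite inE; case: ifP => // _; case: (R x y).
have finj' : injective f by move=> x y; apply: finj; rewrite inE.
by exists (perm finj') => x; rewrite permE; have := fR x; rewrite !inE => /(_ isT)/andP[].
Qed.

Section LatinSquares.
Variable T : finType.
Implicit Types (g h : {perm T}) (L : seq {perm T}) (F : {set {perm T}}).

Definition perm_disj g h := [forall x, g x != h x].

Lemma perm_disjP g h : reflect (forall x, g x != h x) (perm_disj g h).
Proof. exact: forallP. Qed.

Lemma perm_disj_values_uniq L x :
  pairwise perm_disj L -> uniq (map (fun g => g x) L).
Proof.
elim: L => //= g L IH /andP[/allP gL /IH ->]; rewrite andbT.
by apply/mapP=> -[h /gL/perm_disjP/(_ x)/eqP].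
Qed.

Lemma perm_disj_preimages_uniq L y :
  pairwise perm_disj L -> uniq (map (fun g => g^-1 y)%g L).
Proof.
elim: L => //= g L IH /andP[/allP gL /IH ->]; rewrite andbT.
apply/mapP=> -[h /gL/perm_disjP/(_ (g^-1 y)%g) + E].
by rewrite {2}E !permKV eqxx.
Qed.

(** The pairs of a column and a value missing from it form a bipartite graph, regular of degree
    [#|T| - size L]; a perfect matching in it is the new row. *)
Lemma latin_extend1 L :
  pairwise perm_disj L -> size L < #|T| -> exists g, pairwise perm_disj (g :: L).
Proof.
move=> disjL ltL; pose R x y := all (fun g => g x != y) L.
have [|x|y|g gR] := @regular_perfect_matching T R (#|T| - size L).
- by rewrite subn_gt0.
- have <- : #|[set y in map (fun g => g x) L]| = size L.
    by rewrite cardsE (card_uniqP (perm_disj_values_uniq _ disjL)) size_map.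
  rewrite cardsCs; congr (_ - _); apply: eq_card => y; rewrite !inE /R.
  apply/allPn/mapP=> -[g gL]; first by rewrite negbK => /eqP<-; exists g.
  by move=> ->; exists g; rewrite // negbK.
- have <- : #|[set x in map (fun g => g^-1 y)%g L]| = size L.
    by rewrite cardsE (card_uniqP (perm_disj_preimages_uniq _ disjL)) size_map.
  rewrite cardsCs; congr (_ - _); apply: eq_card => x; rewrite !inE /R.
  apply/allPn/mapP=> -[g gL]; first by rewrite negbK => /eqP<-; exists g; rewrite ?permK.
  by move=> ->; exists g; rewrite // negbK permKV.
exists g; rewrite /= disjL andbT; apply/allP=> h hL; apply/perm_disjP=> x.
by have /allP/(_ h hL) := gR x; rewrite eq_sym.
Qed.

Lemma latin_completion L :
  pairwise perm_disj L -> size L <= #|T| ->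
  exists L', pairwise perm_disj (L' ++ L) /\ size (L' ++ L) = #|T|.
Proof.
have [n] := ubnP (#|T| - size L); elim: n => // n IHn in L *; rewrite ltnS => leL disjL.
rewrite leq_eqVlt => /predU1P[eqL|ltL]; first by exists [::].
have [g gL] := latin_extend1 disjL ltL.
have [||L' L'P] := IHn _ _ gL => //=; first by rewrite subnS -ltnS prednK ?subn_gt0 // ltnS.
by exists (rcons L' g); rewrite cat_rcons.
Qed.

Definition perm_intersecting F :=
  forall g h, g \in F -> h \in F -> exists x, g x = h x.

Lemma count_disj_le1 L (P : pred {perm T}) :
  pairwise perm_disj L ->
  (forall g h, P g -> P h -> ~~ perm_disj g h) -> count P L <= 1.
Proof.
move=> + PP; elim: L => //= g L IH /andP[/allP gL /IH leL].
case Pg: (P g) => //; rewrite add1n ltnS leqn0 -leqn0 leqNgt -has_count.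
by apply/hasP=> -[h /gL ghd Ph]; have := PP g h Pg Ph; rewrite ghd.
Qed.

Lemma sum_latin_translates L F :
  \sum_h count (fun g => (g * h)%g \in F) L = size L * #|F|.
Proof.
elim: L => [|g L IH] /=; first by rewrite big1.
rewrite big_split /= IH mulSn; congr (_ + _).
rewrite (reindex_inj (mulgI g^-1%g)) /= -sum1_card [RHS]big_mkcond /=.
by apply: eq_bigr => h _; rewrite mulKVg; case: (h \in F).
Qed.

Lemma card_perms : #|{perm T}| = (#|T|)`!.
Proof.
rewrite -(cardsT T) -card_perm cardE; rewrite -cardE.
by apply: eq_card => g; rewrite !inE; apply/esym/subsetP=> x; rewrite inE.
Qed.

Lemma card_perms_pred : 0 < #|T| -> (#|T|)`! = #|T| * #|T|.-1`!.
Proof. by case: #|T| => // n _; rewrite factS. Qed.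

Lemma count_latin_translate L F h :
  perm_intersecting F -> pairwise perm_disj L ->
  count (fun g => (g * h)%g \in F) L <= 1.
Proof.
move=> intF disjL; apply: count_disj_le1 => // g k gF kF.
apply/negP=> /perm_disjP gk; have [x] := intF _ _ gF kF.
by rewrite !permM => /perm_inj/eqP; rewrite (negPf (gk x)).
Qed.

(** Average over the translates of one Latin square: each has [#|T|] rows, of which at most one is
    in [F]. *)
Lemma perm_intersecting_bound F :
  0 < #|T| -> perm_intersecting F -> #|F| <= #|T|.-1`!.
Proof.
move=> T_gt0 intF; have [//|//|L []] := @latin_completion [::].
rewrite cats0 => disjL szL; rewrite -(leq_pmul2l T_gt0) -card_perms_pred // -card_perms -{1}szL -sum_latin_translates.
rewrite -sum1_card; apply: leq_sum => h _; exact: count_latin_translate.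
Qed.

(** Equality in the average leaves exactly one member in every translate of [L], in particular in
    [L], the translate by 1. *)
Lemma perm_intersecting_max_latin F L :
  0 < #|T| -> perm_intersecting F -> #|F| = #|T|.-1`! ->
  pairwise perm_disj L -> size L = #|T| -> count (mem F) L = 1.
Proof.
move=> T_gt0 intF cF disjL szL.
have sumE : \sum_h count (fun g => (g * h)%g \in F) L = \sum_(h : {perm T}) 1.
  by rewrite sum_latin_translates szL cF -card_perms_pred // -card_perms sum1_card.
have /(_ 1%g)/= := count_latin_translate _ intF disjL.
move=> le1; apply/eqP; move: sumE.
move/eqP; rewrite (eq_sym _ (\sum_h 1)) => /eqP sumE.
have /eqP : \sum_h (1 - count (fun g => (g * h)%g \in F) L) = 0.
  rewrite sumnB => [|h _]; last exact: count_latin_translate.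
  by rewrite sumE subnn.
rewrite sum_nat_eq0 => /forallP/(_ 1%g)/=; rewrite subn_eq0 => ge1.
have -> : count (mem F) L = count (fun g => (g * 1)%g \in F) L.
  by apply: eq_count => g; rewrite mulg1.
by rewrite eqn_leq ge1 le1.
Qed.

(** Complete [g] and [h] to a Latin square. As they carry the same two values, crossed, in columns
    [x] and [y], exchanging these columns in the two rows gives another Latin square with the same
    remaining rows, and each square has exactly one member. *)
Lemma perm_intersecting_max_swap F g h x y :
  0 < #|T| -> perm_intersecting F -> #|F| = #|T|.-1`! ->
  x != y -> perm_disj g h -> h x = g y -> h y = g x ->
  (g \in F) + (h \in F) = (tperm x y * g \in F)%g + (tperm x y * h \in F)%g.
Proof.
move=> T_gt0 intF cF xy gh hx hy.
have T_gt1 : 1 < #|T|.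
  rewrite ltn_neqAle T_gt0 andbT; apply/eqP=> /esym/eqP/fintype1P[z zP].
  by move: xy; rewrite !(zP _) eqxx.
have [|//|L []] := @latin_completion [:: g; h]; first by rewrite /= gh.
rewrite pairwise_cat /= !andbT => /and3P[/allrelP crossL disjL _] szL.
pose g' := (tperm x y * g)%g; pose h' := (tperm x y * h)%g.
have swE k z : (tperm x y * k)%g z = k (tperm x y z) by rewrite permM.
have disj' : pairwise perm_disj (L ++ [:: g'; h']).
  rewrite pairwise_cat /= !andbT disjL /=; apply/andP; split; last first.
    by apply/perm_disjP=> z; rewrite !swE; apply/perm_disjP.
  apply/allrelP=> k u kL; rewrite !inE.
  have kg z : k z != g z by apply/perm_disjP/crossL; rewrite ?inE ?eqxx.
  have kh z : k z != h z by apply/perm_disjP/crossL; rewrite ?inE ?eqxx ?orbT.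
  case/orP=> /eqP->; apply/perm_disjP=> z; rewrite swE; case: tpermP => // ->.
  - by rewrite -hx.
  - by rewrite -hy.
  - by rewrite hy.
  - by rewrite hx.
have := perm_intersecting_max_latin T_gt0 intF cF disj'.
have := perm_intersecting_max_latin T_gt0 intF cF _ szL.
rewrite pairwise_cat /= gh disjL !andbT /=.
have -> : allrel perm_disj L [:: g; h] by apply/allrelP.
by move: szL; rewrite !size_cat /= !count_cat /= => -> /(_ isT) + /(_ erefl); rewrite /g' /h'; lia.
Qed.

End LatinSquares.

(** * Permutations with exactly two fixed points *)

Definition two_fixed_points (T : finType) (rho : {perm T}) (x y : T) :=
  y != x /\ forall c, (rho c == c) = (c == x) || (c == y).

(** [theta] fixes neither [x] nor [y := theta x], so [rho] may fix both; on the other points [c]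
    Hall's theorem gives values avoiding [c] and [theta c]. *)
Lemma two_fixed_points_large (T : finType) (theta : {perm T}) (x : T) :
  5 < #|T| -> theta x != x ->
  exists rho y, two_fixed_points rho x y /\ perm_disj rho theta.
Proof.
move=> T_gt5 thx; pose y := theta x; pose U := ~: [set x; y].
have yx : y != x by [].
have cU : #|U| = #|T| - 2 by rewrite cardsCs setCK cards2 eq_sym yx.
pose R c : {set T} := ~: [set c; theta c].
have [X XU|f fR finj] := @hall_marriage T T x R U U.
  have [->|[c cX]] := set_0Vmem X; first by rewrite cards0.
  (* One point has at least [#|T| - 4] admissible values in [U], which settles small [X]. A larger
     [X] has over two points, while a value is refused by at most two. *)
  have [leX|gtX] := leqP #|X| (#|T| - 4).
    apply: (leq_trans leX); apply: (@leq_trans #|R c :&: U|).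
      have -> : R c :&: U = ~: ([set c; theta c] :|: [set x; y]) by rewrite setCU.
      rewrite [leqRHS]cardsCs setCK; apply: leq_sub2l.
      apply: leq_trans (leq_card_setU _ _).1 _.
      by rewrite !cards2; case: (_ != _); case: (_ != _).
    by apply/subset_leq_card/setSI/(bigcup_sup c).
  apply: leq_trans (subset_leq_card XU) _; apply: subset_leq_card.
  apply/subsetP=> d dU; rewrite inE dU andbT.
  have [/subset_leq_card|/subsetPn[e eX]] :=
      boolP (X \subset [set d; (theta^-1)%g d]).
    by rewrite cards2; case: (_ != _); move: gtX T_gt5; lia.
  rewrite !inE negb_or => /andP[ed eth]; apply/bigcupP; exists e => //.
  rewrite !inE negb_or (eq_sym d) ed /=; apply: contraNneq eth => ->.
  by rewrite permK.
pose r c := if c \in U then f c else c.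
have rU c : c \in U -> r c \in U.
  by rewrite /r => cU'; rewrite cU'; have := fR c cU'; rewrite inE => /andP[].
have rinj : injective r.
  move=> c d; case cU' : (c \in U); case dU : (d \in U).
  - by rewrite /r cU' dU; apply: finj.
  - by move=> E; have := rU c cU'; rewrite E /r dU dU.
  - by move=> E; have := rU d dU; rewrite -E /r cU' cU'.
  - by rewrite /r cU' dU.
exists (perm rinj), y; split.
  split=> // c; rewrite permE /r !inE; case: ifPn => [cxy|]; last first.
    by rewrite negbK eqxx => ->.
  have := fR c; rewrite !inE cxy => /(_ isT)/andP[+ _]; rewrite negb_or => /andP[fc _].
  by rewrite (negPf fc); apply/esym/negbTE.
apply/perm_disjP=> c; rewrite permE /r !inE; case: ifPn => [cxy|].
  by have := fR c; rewrite !inE cxy => /(_ isT)/andP[+ _]; rewrite negb_or => /andP[].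
by rewrite negbK => /orP[]/eqP->; rewrite eq_sym // (inj_eq perm_inj).
Qed.

(** A search by computation, meant for 4 and 5 points, where the counting for Hall's condition falls
    short. Permutations are lists of values. *)
Definition two_fixed_points_check n :=
  let perms := permutations (iota 0 n) in
  let J := iota 0 n in
  all (fun t => all (fun x => (nth 0 t x == x) ||
    has (fun r => has (fun y => (y != x) &&
      all (fun c => ((nth 0 r c == c) == (c == x) || (c == y)) &&
                    (nth 0 r c != nth 0 t c)) J) J) perms) J) perms.

Lemma two_fixed_points_check45 : two_fixed_points_check 4 && two_fixed_points_check 5.
Proof. by vm_compute. Qed.

Lemma two_fixed_points_of_check (T : finType) (theta : {perm T}) (x : T) :
  two_fixed_points_check #|T| -> theta x != x ->
  exists rho y, two_fixed_points rho x y /\ perm_disj rho theta.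
Proof.
move=> chk thx; set n := #|T| in chk.
pose f (i : 'I_n) := enum_rank (theta (enum_val i)).
have finj : injective f.
  by move=> i j /enum_rank_inj/perm_inj/enum_val_inj.
have nthm (g : 'I_n -> 'I_n) (i : 'I_n) : nth 0 [seq val (g j) | j <- enum 'I_n] i = g i.
  by rewrite (nth_map i) ?size_enum_ord // nth_ord_enum.
have uniql : uniq [seq val (f i) | i <- enum 'I_n].
  rewrite map_inj_uniq => [|i j /val_inj/finj //]; exact: enum_uniq.
have lP : [seq val (f i) | i <- enum 'I_n] \in permutations (iota 0 n).
  rewrite mem_permutations; apply: uniq_perm => //; first exact: iota_uniq.
  have [|| //] := uniq_min_size uniql (s2 := iota 0 n).
    by move=> _ /mapP[i _ ->]; rewrite mem_iota /=.
  by rewrite size_map size_iota size_enum_ord.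
have rk (z : T) : (enum_rank z : nat) \in iota 0 n by rewrite mem_iota /=.
have := allP (allP chk _ lP) _ (rk x).
rewrite nthm /f enum_rankK (inj_eq val_inj) (inj_eq enum_rank_inj) (negPf thx) /=.
case/hasP=> r rP /hasP[y yJ /andP[yx /allP chkr]].
have szr : size r = n by move: rP; rewrite mem_permutations => /perm_size->; rewrite size_iota.
have ltr i : i < n -> nth 0 r i < n.
  move=> lti; have : nth 0 r i \in iota 0 n.
    by rewrite -(perm_mem (_ : perm_eq r _)) -?mem_permutations // mem_nth ?szr.
  by rewrite mem_iota.
pose rho z := enum_val (Ordinal (ltr _ (ltn_ord (enum_rank z)))).
have rinj : injective rho.
  move=> z w /enum_val_inj[] E; apply: enum_rank_inj; apply: val_inj.
  apply/eqP; rewrite -(nth_uniq 0 (s := r)) ?szr ?ltn_ord ?E //.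
  by move: rP; rewrite mem_permutations => /perm_uniq->; apply: iota_uniq.
have ltyn : y < n by rewrite mem_iota in yJ.
pose y' := enum_val (Ordinal ltyn).
have ry : enum_rank y' = y :> nat by rewrite enum_valK.
have eqv (z w : T) : (z == w) = (enum_rank z == enum_rank w :> nat).
  by rewrite (inj_eq val_inj) (inj_eq enum_rank_inj).
have rr z : enum_rank (perm rinj z) = nth 0 r (enum_rank z) :> nat.
  by rewrite permE enum_valK.
exists (perm rinj), y'; split.
  split; first by rewrite eqv ry.
  by move=> c; rewrite !eqv ry rr; have /andP[/eqP] := chkr _ (rk c).
apply/perm_disjP=> c; rewrite eqv rr; have /andP[_] := chkr _ (rk c).
by rewrite nthm /f enum_rankK.
Qed.

(** Three points would be too few, since fixing two of them fixes the third. *)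
Lemma two_fixed_points_exists (T : finType) (theta : {perm T}) (x : T) :
  3 < #|T| -> theta x != x ->
  exists rho y, two_fixed_points rho x y /\ perm_disj rho theta.
Proof.
have [/two_fixed_points_large //|le5 gt3 thx] := ltnP 5 #|T|; first by move=> + _; apply.
apply: two_fixed_points_of_check thx; have /andP[] := two_fixed_points_check45.
by have [->|->] : #|T| = 4 \/ #|T| = 5 by move: le5 gt3; lia.
Qed.

(** * Uniqueness of maximum intersecting families of permutations *)

Section MaximumPermutationFamilies.
Variables (T : finType) (F : {set {perm T}}).
Hypotheses (T_gt0 : 0 < #|T|) (intF : perm_intersecting F) (cF : #|F| = #|T|.-1`!).

(* [g] is exchanged against a partner [h] which agrees with [g] on two columns after
   the exchange and is then disjoint from [p]; hence neither [h] nor its exchange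
   is in [F]. *)
Lemma max_perm_move (g p : {perm T}) (x : T) :
  3 < #|T| -> g \in F -> p \in F -> g x != p x ->
  exists2 y, y != x & (tperm x y * g)%g \in F.
Proof.
move=> T_gt3 gF pF gpx.
(* With [theta := p * g^-1], disjointness of [rho] from [theta] says that [rho * g] is disjoint from
   [p]. *)
have [|rho [y [[yx rhoE] /perm_disjP rhoth]]] :=
    @two_fixed_points_exists T (p * g^-1)%g x T_gt3.
  by apply: contraNneq gpx => E; rewrite -{1}E permM permKV.
exists y => //.
(* [h'] agrees with [g] at [x] and [y] only, so transposing these columns makes it disjoint from
   [g]. *)
pose h' := (rho * g)%g; pose h := (tperm x y * h')%g.
have rx : rho x = x by apply/eqP; rewrite rhoE eqxx.
have ry : rho y = y by apply/eqP; rewrite rhoE eqxx orbT.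
have gh : perm_disj g h.
  apply/perm_disjP=> z; rewrite /h /h' !permM (inj_eq perm_inj).
  case: tpermP => [->|->|/eqP zx /eqP zy]; rewrite ?rx ?ry // 1?eq_sym //.
  by rewrite rhoE (negPf zx) (negPf zy).
have hx : h x = g y by rewrite /h /h' !permM tpermL ry.
have hy : h y = g x by rewrite /h /h' !permM tpermR rx.
have xy : x != y by rewrite eq_sym.
have := perm_intersecting_max_swap T_gt0 intF cF xy gh hx hy.
have -> : (tperm x y * h = h')%g by rewrite /h mulgA tperm2 mul1g.
have -> : (h' \in F) = false.
  apply/negbTE/negP=> h'F; have [z] := intF h'F pF.
  rewrite /h' permM => /(congr1 (g^-1)%g); rewrite permK => E.
  by have := rhoth z; rewrite permM -E eqxx.
have -> : (h \in F) = false.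
  apply/negbTE/negP=> hF; have [z /eqP] := intF gF hF.
  by apply/negP; apply/perm_disjP.
by rewrite gF; case: (_ \in F).
Qed.

(* Every member can be moved, one transposition at a time, until it agrees with
   [g0] on [X] only where [p] does too. *)
Lemma max_perm_hitting_step (g0 p : {perm T}) (X : {set T}) :
  3 < #|T| -> p \in F ->
  (forall g, g \in F -> exists2 x, x \in X & g x = g0 x) ->
  forall g, g \in F -> exists2 x, x \in X :&: [set x | p x == g0 x] & g x = g0 x.
Proof.
move=> T_gt3 pF hitX g.
have [n] := ubnP #|[set x in X | (g x == g0 x) && (p x != g0 x)]|.
elim: n g => // n IHn g; rewrite ltnS => leg gF.
have [E|[x]] := set_0Vmem [set x in X | (g x == g0 x) && (p x != g0 x)].
  have [x xX gx] := hitX g gF; exists x => //; rewrite !inE xX /=.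
  by move/setP/(_ x): E; rewrite !inE xX gx eqxx /= => /negbFE.
rewrite !inE => /and3P[xX /eqP gx px].
have [|y yx g'F] := @max_perm_move g p x T_gt3 gF pF; first by rewrite gx eq_sym.
have agree z : (tperm x y * g)%g z = g0 z -> z != x /\ g z = g0 z.
  rewrite permM; case: tpermP => [->|->|/eqP zx _ ->] //.
    by rewrite -gx => /perm_inj/eqP; rewrite (negPf yx).
  by rewrite gx => /perm_inj/esym/eqP; rewrite (negPf yx).
have [|z zX /agree[_ gz]] := IHn _ _ g'F; last by exists z.
apply: leq_trans leg; apply: proper_card; apply/properP; split; last first.
  exists x; first by rewrite !inE xX gx eqxx px.
  rewrite !inE xX /=; apply/negP=> /andP[/eqP/agree[]]; by rewrite eqxx.
apply/subsetP=> z; rewrite !inE => /and3P[-> /eqP/agree[_ ->] ->]; by rewrite eqxx.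
Qed.

(** Applying the hitting step to all members in turn leaves only the columns where they all agree
    with [g0]; these must still be hit by [g0] itself, so one exists. For [#|T| <= 3] there are at
    most two members, and these meet. *)
Lemma perm_intersecting_max_star :
  exists x y, forall g, g \in F -> g x = y.
Proof.
have [g0 g0F] : exists g, g \in F.
  by apply/set0Pn; rewrite -card_gt0 cF fact_gt0.
have [T_gt3|T_le3] := ltnP 3 #|T|.
  have hit s : {subset s <= F} -> forall g, g \in F ->
      exists2 x, x \in [set x | all (fun p : {perm T} => p x == g0 x) s] & g x = g0 x.
    elim: s => [_ g gF|p s IH sF g gF].
      by have [x gx] := intF gF g0F; exists x; rewrite ?inE.
    have {}IH := IH (fun q qs => sF q (mem_behead (s := p :: s) qs)).
    have [x xX gx] := max_perm_hitting_step T_gt3 (sF p (mem_head _ _)) IH gF.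
    by exists x => //; move: xX; rewrite !inE /= andbC.
  have [g|x] := hit (enum F) _ g0 g0F; first by rewrite mem_enum.
  rewrite inE => /allP allx _; exists x, (g0 x) => g gF.
  by apply/eqP/allx; rewrite mem_enum.
have cF2 : #|F| <= 2 by rewrite cF; case: #|T| T_le3 => [|[|[|[|]]]].
have [E|[h]] := set_0Vmem (F :\ g0).
  have [x _] := intF g0F g0F; exists x, (g0 x) => g gF.
  by move/setP/(_ g): E; rewrite !inE gF andbT => /negbFE/eqP->.
rewrite !inE => /andP[hg0 hF]; have [x gh] := intF g0F hF.
exists x, (g0 x) => g gF; have [->//|gg0] := eqVneq g g0.
have [->//|gh'] := eqVneq g h.
have : #|[set g0; h] :|: [set g]| <= 2.
  apply: leq_trans cF2; apply: subset_leq_card; apply/subsetP=> k.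
  by rewrite !inE -orbA => /or3P[]/eqP->.
by rewrite setUC cardsU1 !inE (negPf gg0) (negPf gh') cards2 eq_sym hg0.
Qed.

End MaximumPermutationFamilies.

(** * Matchings in a product *)

Lemma perm_extend (T : finType) (xs ys : seq T) :
  uniq xs -> uniq ys -> size xs = size ys -> exists g : {perm T}, map g xs = ys.
Proof.
elim: xs ys => [|x xs IH] [|y ys] //=; first by exists 1%g.
case/andP=> xxs uxs /andP[yys uys] [sz]; have [g gE] := IH ys uxs uys sz.
exists (g * tperm (g x) y)%g; rewrite permM tpermL; congr (_ :: _).
rewrite -[RHS]gE; apply/eq_in_map=> z zxs; rewrite permM tpermD //.
  by rewrite (inj_eq perm_inj); apply: contraNneq xxs => ->.
by apply: contraNneq yys => ->; rewrite -gE map_f.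
Qed.

Lemma perm_extend_in (T A : finType) (P : {set A}) (f g : A -> T) :
  {in P &, injective f} -> {in P &, injective g} ->
  exists s : {perm T}, {in P, forall p, s (f p) = g p}.
Proof.
move=> finj ginj.
have um (h : A -> T) : {in P &, injective h} -> uniq (map h (enum P)).
  move=> hinj; rewrite map_inj_in_uniq ?enum_uniq // => x y.
  by rewrite !mem_enum; apply: hinj.
have [|s sE] := perm_extend (um f finj) (um g ginj); first by rewrite !size_map.
exists s => p pP; move: sE; rewrite -map_comp => /eq_in_map; apply.
by rewrite mem_enum.
Qed.

Lemma card_perm_agree (T : finType) (X : {set T}) (g0 : {perm T}) :
  #|[set g : {perm T} | [forall x in X, g x == g0 x]]| = (#|T| - #|X|)`!.
Proof.
rewrite -[in RHS](cardsC X) addKn -card_perm.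
rewrite -[RHS](card_imset _ (mulIg g0)); apply: eq_card => g.
rewrite inE; apply/forall_inP/imsetP => [gE|[h hX ->] x xX].
  exists (g * g0^-1)%g; last by rewrite mulgKV.
  apply/subsetP=> x; rewrite !inE; apply: contraNN => xX.
  by rewrite permM (eqP (gE x xX)) permK.
rewrite permM (out_perm hX) ?eqxx // inE negbK; exact: xX.
Qed.

Section Matchings.
Variables (E : finType) (d : rel E).
Implicit Types (M N : {set E}) (F : {set {set E}}).

Definition matchings r := [set M : {set E} |
  [forall e in M, forall f in M, (e != f) ==> d e f] & #|M| == r].

Definition mstar r e := [set M in matchings r | e \in M].

Definition meets F :=
  forall M N, M \in F -> N \in F -> exists e, e \in M /\ e \in N.

Definition star_bound r s :=
  (forall e, #|mstar r e| = s) /\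
  (forall F, F \subset matchings r -> meets F -> #|F| <= s).

Definition star_unique r s :=
  forall F, F \subset matchings r -> meets F -> #|F| = s -> 0 < s ->
  exists e, forall M, M \in F -> e \in M.

Lemma matchingsP r M :
  reflect ({in M &, forall e f, e != f -> d e f} /\ #|M| = r) (M \in matchings r).
Proof.
rewrite inE; apply: (iffP andP) => -[] => [dM /eqP->|dM ->]; split=> //.
  by move=> e f eM fM ef; move/forall_inP/(_ e eM)/forall_inP/(_ f fM)/implyP: dM; apply.
apply/forall_inP=> e eM; apply/forall_inP=> f fM; apply/implyP; exact: dM.
Qed.

Lemma star_unique1 s : star_unique 1 s.
Proof.
move=> F sF intF cF s_gt0; have /set0Pn[M MF] : F != set0 by rewrite -card_gt0 cF.
have /matchingsP[_ /eqP/cards1P[e ME]] := subsetP sF M MF.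
exists e => N NF; have [f [+ fN]] := intF M N MF NF.
by rewrite ME inE => /eqP<-.
Qed.

Lemma mem_mstar r e M : (M \in mstar r e) = (M \in matchings r) && (e \in M).
Proof. by rewrite in_set. Qed.

End Matchings.

(* [X] is the product of [E] and [B], presented by its projections and its pairing
   so that dependent functions can be used without transport. *)
Section Product.
Variables (E B X : finType) (d : rel E) (dX : rel X).
Variables (p1 : X -> E) (p2 : X -> B) (mk : E -> B -> X).
Hypotheses (mk1 : forall e b, p1 (mk e b) = e) (mk2 : forall e b, p2 (mk e b) = b).
Hypothesis mkK : forall x, mk (p1 x) (p2 x) = x.
Hypothesis dXE : forall x y, dX x y = d (p1 x) (p1 y) && (p2 x != p2 y).
Hypothesis d_irr : irreflexive d.
Implicit Types (M N : {set X}) (P Q : {set E}) (F : {set {set X}}) (x y z : X).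

Lemma matching_p1_inj r M : M \in matchings dX r -> {in M &, injective p1}.
Proof.
case/matchingsP=> dM _ x y xM yM xy; apply/eqP/negP=> /negP/(dM x y xM yM).
by rewrite dXE xy d_irr.
Qed.

Lemma matching_p2_inj r M : M \in matchings dX r -> {in M &, injective p2}.
Proof.
case/matchingsP=> dM _ x y xM yM xy; apply/eqP/negP=> /negP/(dM x y xM yM).
by rewrite dXE xy eqxx andbF.
Qed.

Lemma matching_p1 r M : M \in matchings dX r -> p1 @: M \in matchings d r.
Proof.
move=> Mm; case/matchingsP: (Mm) => dM cM; apply/matchingsP; split; last first.
  by rewrite card_in_imset //; apply: matching_p1_inj Mm.
move=> _ _ /imsetP[x xM ->] /imsetP[y yM ->] xy.
have := dM x y xM yM; rewrite dXE => /(_ _)/andP[] //.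
by apply: contraNneq xy => ->.
Qed.

Section Relabelling.
Variable s : {perm B}.

Definition relabel x := mk (p1 x) (s (p2 x)).

Lemma relabel_inj : injective relabel.
Proof.
move=> x y E2; rewrite -(mkK x) -(mkK y); congr mk.
  by move/(congr1 p1): E2; rewrite !mk1.
by move/(congr1 p2): E2; rewrite !mk2 => /perm_inj.
Qed.

Lemma relabel_matching r M :
  M \in matchings dX r -> relabel @: M \in matchings dX r.
Proof.
case/matchingsP=> dM cM; apply/matchingsP; rewrite card_imset //; last exact: relabel_inj.
split=> // _ _ /imsetP[x xM ->] /imsetP[y yM ->] xy.
have := dM x y xM yM; rewrite !dXE !mk1 !mk2 (inj_eq perm_inj); apply.
by apply: contraNneq xy => ->.
Qed.

Lemma relabel_p1 M : p1 @: (relabel @: M) = p1 @: M.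
Proof. by rewrite -imset_comp; apply: eq_imset => x /=; rewrite mk1. Qed.

End Relabelling.

(* Exchanging the label of a common edge of two matchings destroys this common
   edge and creates no new one. *)
Lemma relabel_disagree r r' M N y b :
  M \in matchings dX r -> N \in matchings dX r' -> y \in M -> y \in N ->
  b != p2 y ->
  relabel (tperm (p2 y) b) @: M :&: N \proper M :&: N.
Proof.
move=> Mm Nm yM yN by_; apply/properP.
have yout : y \notin relabel (tperm (p2 y) b) @: M.
  apply/imsetP=> -[w wM]; rewrite /relabel => yE.
  move: (congr1 p1 yE) (congr1 p2 yE); rewrite mk1 mk2.
  move/(matching_p1_inj Mm yM wM) => <-; rewrite tpermL => /esym/eqP.
  by rewrite (negPf by_).
split; last by exists y; rewrite !inE ?yM // (negPf yout).
apply/subsetP=> _ /setIP[/imsetP[w wM ->]]; rewrite /relabel.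
case: tpermP => [wy|wb|_ _]; last by rewrite mkK inE wM.
  have -> : w = y by apply: matching_p2_inj Mm _ _ wM yM wy.
  move=> mN; have := matching_p1_inj Nm mN yN; rewrite mk1 => /(_ erefl).
  by move/(congr1 p2)/eqP; rewrite mk2 (negPf by_).
move=> mN; have := matching_p2_inj Nm mN yN; rewrite mk2 => /(_ erefl) mE.
have wyE : w = y by apply: matching_p1_inj Mm _ _ wM yM _; rewrite -mE mk1.
by move: by_; rewrite -wb wyE eqxx.
Qed.

Lemma relabel_keep M x b c :
  x \in M -> p2 x != b -> p2 x != c -> x \in relabel (tperm b c) @: M.
Proof.
move=> xM xb xc; apply/imsetP; exists x => //.
by rewrite /relabel tpermD ?mkK // eq_sym.
Qed.

Definition fibre r P := [set M in matchings dX r | p1 @: M == P].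

Lemma mem_fibre r P M :
  (M \in fibre r P) = (M \in matchings dX r) && (p1 @: M == P).
Proof. by rewrite in_set. Qed.

(** * Matchings with a given trace *)

Section Fibre.
Variables (r : nat) (P : {set E}).
Hypotheses (r_gt0 : 0 < r) (Pm : P \in matchings d r) (rB : r <= #|B|).

(** A matching with trace [P] is an injection of [P] into [B]. Once [iota] places [P] inside [B],
    such injections are the restrictions of permutations of [B] to [iota @: P]. *)
Lemma fibre_parametrization : exists phi : {perm B} -> {set X},
  exists iota : E -> B,
  [/\ {in P &, injective iota},
      forall g, phi g \in fibre r P,
      forall M, M \in fibre r P -> exists g, phi g = M &
      forall g e b, (mk e b \in phi g) = (e \in P) && (g (iota e) == b)].
Proof.
have cP : #|P| = r by case/matchingsP: Pm.
have [b0 _] : exists b, b \in B by apply/card_gt0P; apply: leq_trans rB.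
pose iota e := nth b0 (enum B) (index e (enum P)).
have iota_inj : {in P &, injective iota}.
  move=> e f eP fP /eqP; rewrite nth_uniq ?enum_uniq -?cardE ?(leq_trans _ rB) //.
  - by move/eqP; apply: (index_inj e); rewrite mem_enum.
  - by rewrite -cP [#|P|]cardE index_mem mem_enum.
  - by rewrite -cP [#|P|]cardE index_mem mem_enum.
pose phi (g : {perm B}) := [set mk e (g (iota e)) | e in P].
have mem_phi g e b : (mk e b \in phi g) = (e \in P) && (g (iota e) == b).
  apply/imsetP/andP=> [[f fP fE]|[eP /eqP<-]]; last by exists e.
  have ef : e = f by move: (congr1 p1 fE); rewrite !mk1.
  by rewrite ef fP; move: (congr1 p2 fE); rewrite !mk2 => ->.
have p1phi g : p1 @: phi g = P.
  rewrite -imset_comp -[RHS]imset_id; apply: eq_imset => e /=; exact: mk1.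
exists phi, iota; split=> // [g|M].
  rewrite inE p1phi eqxx andbT; apply/matchingsP; split; last first.
    by rewrite card_in_imset // => e f _ _ /(congr1 p1); rewrite !mk1.
  move=> _ _ /imsetP[e eP ->] /imsetP[f fP ->] ef; rewrite dXE !mk1 !mk2.
  have {}ef : e != f by apply: contraNneq ef => ->.
  have /matchingsP[dP _] := Pm; rewrite dP //= (inj_eq perm_inj).
  by apply: contraNneq ef => /iota_inj->.
rewrite inE => /andP[Mm /eqP p1M].
pose tau e := if [pick x in M | p1 x == e] is Some x then p2 x else b0.
have tauM e : e \in P -> mk e (tau e) \in M.
  rewrite -p1M /tau => /imsetP[x xM ->]; case: pickP => [y /andP[yM /eqP<-]|].
    by rewrite mkK.
  by move/(_ x); rewrite xM eqxx.
have [|g gE] := @perm_extend_in _ _ P iota tau iota_inj.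
  move=> e f eP fP eftau.
  have := matching_p2_inj Mm (tauM e eP) (tauM f fP).
  by rewrite !mk2 => /(_ eftau)/(congr1 p1); rewrite !mk1.
exists g; apply/eqP; rewrite eqEcard; apply/andP; split.
  by apply/subsetP=> _ /imsetP[e eP ->]; rewrite gE // tauM.
have /matchingsP[_ ->] := Mm.
by rewrite card_in_imset ?cP // => e f _ _ /(congr1 p1); rewrite !mk1.
Qed.

(** Every member of the fibre has the same number of preimages under [phi], so the results for
    permutations descend to the fibre. For uniqueness the column on which all permutations agree
    must moreover come from [P]. *)
Lemma fibre_properties :
  [/\ forall x, p1 x \in P -> #|[set M in fibre r P | x \in M]| = #|B|.-1 ^_ r.-1,
      forall F, F \subset fibre r P -> meets F -> #|F| <= #|B|.-1 ^_ r.-1 &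
      forall F, F \subset fibre r P -> meets F -> #|F| = #|B|.-1 ^_ r.-1 ->
        1 < r -> exists2 x, p1 x \in P & forall M, M \in F -> x \in M].
Proof.
have cP : #|P| = r by case/matchingsP: Pm.
have [phi [iota [iota_inj phiF phi_onto mem_phi]]] := fibre_parametrization.
have B_gt0 : 0 < #|B| by apply: leq_trans rB.
have c_gt0 := fact_gt0 (#|B| - r).
have phiE g h : (phi g == phi h) = [forall b in iota @: P, g b == h b].
  apply/eqP/forall_inP=> [gh _ /imsetP[e eP ->]|gh].
    have : mk e (h (iota e)) \in phi g by rewrite gh mem_phi eP eqxx.
    by rewrite mem_phi => /andP[].
  apply/setP=> x; rewrite -(mkK x) !mem_phi; case eP: (_ \in P) => //=.
  by rewrite (eqP (gh _ (imset_f iota eP))).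
pose pre F := [set g | phi g \in F].
have card_pre F : F \subset fibre r P -> #|pre F| = #|F| * (#|B| - r)`!.
  move=> sF; rewrite -sum1_card (partition_big phi (mem F)) /=; last first.
    by move=> g; rewrite inE.
  rewrite -sum_nat_const; apply: eq_bigr => M MF.
  have [g0 g0M] := phi_onto M (subsetP sF M MF).
  have := card_perm_agree (iota @: P) g0; rewrite card_in_imset // cP => <-.
  rewrite -sum1_card; apply: eq_bigl => g; rewrite !inE -phiE g0M.
  by case: eqP => [->|]; rewrite ?MF ?andbF.
have factE : #|B|.-1`! = #|B|.-1 ^_ r.-1 * (#|B| - r)`!.
  have -> : #|B| - r = #|B|.-1 - r.-1 by move: B_gt0 r_gt0; lia.
  by rewrite ffact_fact //; move: rB r_gt0; lia.
have int_pre F : meets F -> perm_intersecting (pre F).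
  move=> mF g h; rewrite !inE => gF hF; have [x []] := mF _ _ gF hF.
  rewrite -(mkK x) !mem_phi => /andP[_ /eqP gx] /andP[_ /eqP hx].
  by exists (iota (p1 x)); rewrite gx hx.
have card_star b c : #|[set g : {perm B} | g b == c]| = #|B|.-1`!.
  have := card_perm_agree [set b] (tperm b c); rewrite cards1 subn1 => <-.
  apply: eq_card => g; rewrite !inE; apply/eqP/forall_inP => [gb a|/(_ b)].
    by rewrite inE => /eqP->; rewrite gb tpermL.
  by rewrite inE eqxx tpermL => /(_ isT)/eqP.
split=> [x xP|F sF mF|F sF mF cF r_gt1].
- apply/eqP; rewrite -(eqn_pmul2r c_gt0) -factE -(card_star (iota (p1 x)) (p2 x)).
  rewrite -card_pre; last by apply/subsetP=> M; rewrite inE => /andP[].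
  apply/eqP; congr #|pred_of_set _|; apply/setP=> g.
  by rewrite [LHS]in_set [RHS]in_set in_set phiF -{1}(mkK x) mem_phi xP.
- rewrite -(leq_pmul2r c_gt0) -factE -card_pre //.
  by apply: perm_intersecting_bound => //; apply: int_pre.
have cpre : #|pre F| = #|B|.-1`! by rewrite card_pre // cF factE.
have [b [c bc]] := perm_intersecting_max_star B_gt0 (int_pre F mF) cpre.
have [/imsetP[e eP bE]|bP] := boolP (b \in iota @: P).
  exists (mk e c) => [|M MF]; first by rewrite mk1.
  have [g gM] := phi_onto M (subsetP sF M MF).
  by rewrite -gM mem_phi eP -bE (bc g) ?eqxx // inE gM.
(* If [b] lies off [iota @: P], then [pre F] holds all permutations sending [b] to [c]. Rotating the
   columns of [P] by [k] turns one of them into another that shares no edge with it over [P], as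
   [r > 1]. *)
have preE : pre F = [set g : {perm B} | g b == c].
  apply/eqP; rewrite eqEcard card_star cpre leqnn andbT.
  by apply/subsetP=> g /bc; rewrite inE => ->.
pose xs := map iota (enum P).
have uxs : uniq xs.
  rewrite map_inj_in_uniq ?enum_uniq // => e f; rewrite !mem_enum; exact: iota_inj.
have szxs : size xs = r by rewrite size_map -cardE.
have bxs : b \notin xs.
  apply: contraNN bP => /mapP[e]; rewrite mem_enum => eP ->; exact: imset_f.
have [|||k [kb kxs]] := @perm_extend B (b :: xs) (b :: rot 1 xs).
- by rewrite /= bxs.
- by rewrite /= mem_rot bxs rot_uniq.
- by rewrite /= size_rot.
have /set0Pn[g gF] : pre F != set0 by rewrite -card_gt0 cpre fact_gt0.
have kgF : (k * g)%g \in pre F by move: gF; rewrite preE !inE permM kb.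
rewrite !in_set in kgF gF; have [x []] := mF _ _ kgF gF.
rewrite -(mkK x) !mem_phi => /andP[xP /eqP<-] /andP[_ /eqP].
rewrite permM => /perm_inj kx; move: kxs.
have : iota (p1 x) \in xs by rewrite map_f ?mem_enum.
case: xs uxs szxs {bxs} => // a l ual szl ixl; rewrite rot1_cons => kal.
have ilt : index (iota (p1 x)) (a :: l) < (size l).+1 by rewrite -index_mem in ixl.
have : nth b (map k (a :: l)) (index (iota (p1 x)) (a :: l)) =
    nth b (rcons l a) (index (iota (p1 x)) (a :: l)) by rewrite kal.
rewrite (nth_map b) // nth_index // -kx nth_rcons.
(* A fixed point of the rotation at the last position forces a list of length one, elsewhere a
   repeated entry. *)
set i := index _ _ in ilt *; move: ilt; rewrite ltnS leq_eqVlt => /predU1P[il|il].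
  rewrite il ltnn eqxx => ia; move: il; rewrite /i ia /= eqxx => l0.
  by move: szl r_gt1; rewrite /= -l0 => <-.
rewrite il => /(congr1 (index ^~ (a :: l))); rewrite -/i.
rewrite -[nth b l i]/(nth b (a :: l) i.+1) index_uniq //.
by move/eqP; rewrite -[i in i == _]addn0 -addn1 eqn_add2l.
Qed.

End Fibre.

(** * Bound and uniqueness in the product *)

Lemma product_star_card r s :
  0 < r <= #|B| -> (forall e, #|mstar d r e| = s) ->
  forall x, #|mstar dX r x| = s * #|B|.-1 ^_ r.-1.
Proof.
case/andP=> r_gt0 rB star_d x.
rewrite -sum1_card (partition_big (fun M => p1 @: M) (mem (mstar d r (p1 x)))) /=.
  rewrite -(star_d (p1 x)) -sum_nat_const; apply: eq_bigr => P.
  rewrite mem_mstar => /andP[Pm xP].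
  have [/(_ x xP) <- _ _] := fibre_properties r_gt0 Pm rB.
  rewrite -sum1_card; apply: eq_bigl => M.
  by rewrite [RHS]in_set mem_fibre mem_mstar andbAC.
by move=> M; rewrite !mem_mstar => /andP[/matching_p1-> xM]; rewrite imset_f.
Qed.

Lemma product_star_bound r s :
  0 < r <= #|B| -> star_bound d r s -> star_bound dX r (s * #|B|.-1 ^_ r.-1).
Proof.
move=> rB [star_d bound_d]; split=> [|F sF mF]; first exact: product_star_card.
case/andP: rB => r_gt0 rB.
rewrite -sum1_card (partition_big (fun M => p1 @: M) (mem ((fun M => p1 @: M) @: F))) /=;
  last by move=> M MF; apply: imset_f.
apply: (@leq_trans (\sum_(P in (fun M => p1 @: M) @: F) #|B|.-1 ^_ r.-1)).
  apply: leq_sum => P /imsetP[M0 M0F ->].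
  have [_ + _] := fibre_properties r_gt0 (matching_p1 (subsetP sF _ M0F)) rB.
  have -> : \sum_(M in F | p1 @: M == p1 @: M0) 1 =
      #|[set M in F | p1 @: M == p1 @: M0]|.
    by rewrite -sum1_card; apply: eq_bigl => M; rewrite inE.
  apply=> [|M N]; last by rewrite !inE => /andP[MF _] /andP[NF _]; apply: mF.
  by apply/subsetP=> M; rewrite in_set mem_fibre => /andP[/(subsetP sF)-> ->].
rewrite sum_nat_const leq_mul2r bound_d ?orbT //.
  by apply/subsetP=> _ /imsetP[M MF ->]; apply/matching_p1/(subsetP sF).
move=> _ _ /imsetP[M MF ->] /imsetP[N NF ->]; have [x [xM xN]] := mF M N MF NF.
by exists (p1 x); rewrite !imset_f.
Qed.

(** Induction on the size of the intersection. In a matching whose centre is not the common edge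
    [y], the label of [y] is exchanged with that of a third edge, which [r > 2] provides; trace and
    centre are kept. *)
Lemma fibre_stars_meet r (P P' : {set E}) x x' :
  2 < r -> P \in matchings d r -> P' \in matchings d r -> x != x' ->
  (exists2 M, M \in fibre r P & x \in M) -> (exists2 M, M \in fibre r P' & x' \in M) ->
  exists M M', [/\ M \in fibre r P, M' \in fibre r P', x \in M, x' \in M' & [disjoint M & M']].
Proof.
move=> r_gt2 Pm P'm xx' [M MP xM] [M' M'P' xM'].
have [n] := ubnP #|M' :&: M|; elim: n => // n IHn in M MP xM M' M'P' xM' *; rewrite ltnS => leM.
have Mm : M \in matchings dX r by move: MP; rewrite mem_fibre => /andP[].
have M'm : M' \in matchings dX r by move: M'P'; rewrite mem_fibre => /andP[].
have [E0|[y /setIP[yM' yM]]] := set_0Vmem (M' :&: M).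
  by exists M, M'; split=> //; rewrite disjoint_sym -setI_eq0 E0.
have third (N : {set X}) u v : N \in matchings dX r -> exists z, [&& z \in N, z != u & z != v].
  case/matchingsP=> _ cN; have : 0 < #|N :\: [set u; v]|.
    rewrite cardsD subn_gt0 cN; apply: leq_trans r_gt2.
    rewrite ltnS (leq_trans (subset_leq_card (subsetIr _ _))) // cards2.
    by case: (_ != _).
  by case/card_gt0P=> z; rewrite !inE negb_or -andbA => /and3P[zu zv zN]; exists z; apply/and3P.
have fibre_relabel (N : {set X}) Q s : N \in fibre r Q -> relabel s @: N \in fibre r Q.
  by rewrite !mem_fibre relabel_p1 => /andP[/relabel_matching-> ->].
have [yx'|yx'] := eqVneq y x'.
  have [z /and3P[zM zx zy]] := third M x y Mm.
  have zly : p2 z != p2 y by apply: contraNneq zy => /(matching_p2_inj Mm zM yM)->.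
  apply: (IHn (relabel (tperm (p2 y) (p2 z)) @: M) _ _ M') => //.
  - exact: fibre_relabel.
  - apply: relabel_keep => //.
      by apply: contraNneq xx' => /(matching_p2_inj Mm xM yM)->; rewrite yx'.
    by apply: contraNneq zx => /(matching_p2_inj Mm xM zM)->.
  by apply: leq_trans leM; rewrite setIC [M' :&: M]setIC proper_card // (relabel_disagree Mm M'm).
have [z /and3P[zM' zx' zy]] := third M' x' y M'm.
have zly : p2 z != p2 y by apply: contraNneq zy => /(matching_p2_inj M'm zM' yM')->.
apply: (IHn M _ _ (relabel (tperm (p2 y) (p2 z)) @: M')) => //.
- exact: fibre_relabel.
- apply: relabel_keep => //.
    by apply: contraNneq yx' => /(matching_p2_inj M'm xM' yM')->.
  by apply: contraNneq zx' => /(matching_p2_inj M'm xM' zM')->.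
by apply: leq_trans leM; rewrite proper_card // (relabel_disagree M'm Mm).
Qed.

Lemma product_star_unique_gt2 r s :
  2 < r <= #|B| -> star_bound d r s -> star_unique dX r (s * #|B|.-1 ^_ r.-1).
Proof.
case/andP=> r_gt2 rB [star_d bound_d] F sF mF cF s_gt0.
have r_gt0 : 0 < r by apply: leq_trans r_gt2.
set t := #|B|.-1 ^_ r.-1 in cF s_gt0.
pose F1 := (fun M => p1 @: M) @: F; pose FP P := [set M in F | p1 @: M == P].
have F1m P : P \in F1 -> P \in matchings d r.
  by case/imsetP=> M MF ->; apply/matching_p1/(subsetP sF).
have sFP P : FP P \subset fibre r P.
  by apply/subsetP=> M; rewrite in_set mem_fibre => /andP[/(subsetP sF)-> ->].
have mFP P : meets (FP P).
  by move=> M N; rewrite !inE => /andP[MF _] /andP[NF _]; apply: mF.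
have leFP P : P \in F1 -> #|FP P| <= t.
  by move=> /F1m Pm; have [_ + _] := fibre_properties r_gt0 Pm rB; apply.
have cF1 : #|F1| <= s.
  apply: bound_d; first by apply/subsetP.
  move=> _ _ /imsetP[M MF ->] /imsetP[N NF ->]; have [x [xM xN]] := mF M N MF NF.
  by exists (p1 x); rewrite !imset_f.
have sumFP : \sum_(P in F1) #|FP P| = s * t.
  rewrite -cF -[#|F|]sum1_card (partition_big (fun M => p1 @: M) (mem F1)) /=;
    last by move=> M MF; apply: imset_f.
  apply: eq_bigr => P _; rewrite -sum1_card; apply: eq_bigl => M.
  by rewrite inE.
have cFP P : P \in F1 -> #|FP P| = t.
  have : \sum_(P in F1) (t - #|FP P|) = 0.
    rewrite sumnB // sumFP sum_nat_const; apply/eqP; rewrite subn_eq0.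
    by rewrite leq_mul2r cF1 orbT.
  move/eqP; rewrite sum_nat_eq0 => /forall_inP FP0 PF1.
  by apply/eqP; rewrite eqn_leq leFP //= -subn_eq0 FP0.
have star_fibre P : P \in F1 -> exists x, FP P = [set M in fibre r P | x \in M].
  move=> PF1; have [cs _ uniq] := fibre_properties r_gt0 (F1m P PF1) rB.
  have [x xP allx] := uniq _ (sFP P) (@mFP P) (cFP P PF1) (ltnW r_gt2).
  exists x; apply/eqP; rewrite eqEcard cs // cFP // leqnn andbT.
  by apply/subsetP=> M MF; rewrite inE allx // (subsetP (sFP P)).
have FPF (M : {set X}) : M \in F -> M \in FP (p1 @: M) by rewrite inE eqxx andbT.
have /set0Pn[M0 M0F] : F != set0 by rewrite -card_gt0 cF.
have P0F1 : p1 @: M0 \in F1 by apply: imset_f.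
have [x0 FP0] := star_fibre _ P0F1.
have M0x : M0 \in fibre r (p1 @: M0) /\ x0 \in M0.
  by have := FPF M0 M0F; rewrite FP0 in_set => /andP[].
exists x0 => M MF; have PF1 : p1 @: M \in F1 by apply: imset_f.
have [x FPx] := star_fibre _ PF1.
have Mx : M \in fibre r (p1 @: M) /\ x \in M.
  by have := FPF M MF; rewrite FPx in_set => /andP[].
have [->|x0x] := eqVneq x0 x; first by case: Mx.
have [||N0 [N [N0P NP x0N0 xN disjN]]] := fibre_stars_meet r_gt2 (F1m _ P0F1) (F1m _ PF1) x0x.
- by exists M0; case: M0x.
- by exists M; case: Mx.
have N0F : N0 \in FP (p1 @: M0) by rewrite FP0 in_set N0P.
have NF : N \in FP (p1 @: M) by rewrite FPx in_set NP.
move: N0F NF; rewrite !in_set => /andP[N0F _] /andP[NF _].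
have [y [yN0 yN]] := mF _ _ N0F NF.
by move/pred0P/(_ y): disjN; rewrite /= yN0 yN.
Qed.

(* Pairwise intersecting pairs without a common element form a triangle, and three
   disjoint edges give a star of size at least four. *)
Lemma product_star_unique2 s :
  (forall x, #|mstar dX 2 x| = s) -> star_unique dX 2 s.
Proof.
move=> star_s F sF mF cF s_gt0.
have [/existsP[e /forall_inP eF]|/existsPn nostar] :=
  boolP [exists e, [forall M in F, e \in M]]; first by exists e.
have avoid e : exists2 M, M \in F & e \notin M.
  by have /forall_inPn[M MF eM] := nostar e; exists M.
have pair M u : M \in F -> u \in M -> exists2 v, u != v & M = [set u; v].
  move=> /(subsetP sF)/matchingsP[_ /eqP/cards2P[v [w [vw ->]]]].
  rewrite !inE => /orP[]/eqP->; first by exists w.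
  by exists v; rewrite 1?eq_sym // setUC.
have [M MF] : exists M, M \in F by apply/card_gt0P; rewrite cF.
have [a aM] : exists a, a \in M by have [a [aM _]] := mF M M MF MF; exists a.
have [b ab ME] := pair M a MF aM.
have [N NF aN] := avoid a; have [L LF bL] := avoid b.
have bN : b \in N.
  have [u []] := mF M N MF NF; rewrite ME !inE => /orP[]/eqP-> //.
  by rewrite (negPf aN).
have [c bc NE] := pair N b NF bN.
have ac : a != c by apply: contraNneq aN => ->; rewrite NE !inE eqxx orbT.
have aL : a \in L.
  have [u []] := mF M L MF LF; rewrite ME !inE => /orP[]/eqP-> //.
  by rewrite (negPf bL).
have cL : c \in L.
  have [u []] := mF N L NF LF; rewrite NE !inE => /orP[]/eqP-> //.
  by rewrite (negPf bL).
have LE : L = [set a; c].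
  have [v av LE] := pair L a LF aL; move: cL; rewrite LE !inE eq_sym (negPf ac) /=.
  by move/eqP->.
(* A pair that meets all three sides of the triangle is one of them. *)
have cF3 : #|F| <= 3.
  have -> : 3 = 1 + #|[set N; L]|.+1.-1 by rewrite cards2; case: eqP => // NL; rewrite NL aL in aN.
  apply: leq_trans (subset_leq_card _) (_ : #|M |: [set N; L]| <= _); last first.
    by rewrite cardsU1; case: (_ \notin _).
  apply/subsetP=> K KF; have [aK|aK] := boolP (a \in K).
    have [k ak KE] := pair K a KF aK; have [u []] := mF K N KF NF.
    rewrite KE NE !inE => /orP[]/eqP->; first by rewrite (negPf ab) (negPf ac).
    by rewrite ME LE => /orP[]/eqP->; rewrite eqxx ?orbT.
  have bK : b \in K.
    have [u []] := mF M K MF KF; rewrite ME !inE => /orP[]/eqP-> //.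
    by rewrite (negPf aK).
  have cK : c \in K.
    have [u []] := mF L K LF KF; rewrite LE !inE => /orP[]/eqP-> //.
    by rewrite (negPf aK).
  have [k bk KE] := pair K b KF bK; move: cK; rewrite !inE KE !inE eq_sym (negPf bc) /=.
  by move/eqP=> ck; rewrite -ck NE eqxx !orbT.
have dis (K : {set X}) u v : K \in F -> u \in K -> v \in K -> u != v ->
    d (p1 u) (p1 v) /\ p2 u != p2 v.
  by move=> /(subsetP sF)/matchingsP[dK _] uK vK /(dK u v uK vK); rewrite dXE => /andP[].
have bM : b \in M by rewrite ME !inE eqxx orbT.
have cN : c \in N by rewrite NE !inE eqxx orbT.
have [dab lab] := dis M a b MF aM bM ab.
have [dac lac] := dis L a c LF aL cL ac.
have [dbc lbc] := dis N b c NF bN cN bc.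
have [|dba _] := dis M b a MF bM aM; first by rewrite eq_sym.
have [|dca _] := dis L c a LF cL aL; first by rewrite eq_sym.
have pbc : p1 b != p1 c by apply/eqP=> pbc; move: dbc; rewrite pbc d_irr.
(* Exchanging the labels of [b] and [c] gives two further edges disjoint from [a], hence four
   members of the star of [a]. *)
pose x := mk (p1 b) (p2 c); pose x' := mk (p1 c) (p2 b).
pose Z := [:: b; c; x; x'].
have uZ : uniq Z.
  have neq1 u v : p1 u != p1 v -> u != v by apply: contra_neq => ->.
  have neq2 u v : p2 u != p2 v -> u != v by apply: contra_neq => ->.
  rewrite /= !inE !negb_or bc (neq2 b x) ?mk2 // (neq1 b x') ?mk1 //.
  have -> : c != x by apply: neq1; rewrite mk1 eq_sym.
  have -> : c != x' by apply: neq2; rewrite mk2 eq_sym.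
  by rewrite (neq1 x x') ?mk1.
have dZ z : z \in Z -> [/\ d (p1 a) (p1 z), d (p1 z) (p1 a) & p2 a != p2 z].
  by rewrite !inE => /or4P[]/eqP->; rewrite ?mk1 ?mk2.
have aZ z : z \in Z -> a != z.
  by case/dZ=> dz _ _; apply/eqP=> az; rewrite az d_irr in dz.
have : #|[set [set a; z] | z in Z]| <= #|mstar dX 2 a|.
  apply/subset_leq_card/subsetP=> _ /imsetP[z zZ ->]; rewrite mem_mstar set21 andbT.
  have [d1 d2 lz] := dZ z zZ.
  apply/matchingsP; rewrite cards2 (aZ z zZ); split=> // u v.
  rewrite !inE => /orP[]/eqP-> /orP[]/eqP->; rewrite ?eqxx // dXE ?d1 ?d2 //= ?lz //.
  by rewrite (eq_sym (p2 z)) lz.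
rewrite star_s -cF card_in_imset.
  by rewrite (card_uniqP uZ) => /leq_trans/(_ cF3).
move=> z w zZ wZ /setP/(_ z); rewrite !inE eqxx orbT eq_sym (negPf (aZ z zZ)) /=.
by move/esym/eqP.
Qed.

(** A common edge other than [e] moves within [M] to a label that [M] does not use, available since
    [r < #|B|]. If it is [e], it is relabelled within [N], where [s > 2] leaves an edge besides [e]
    and [f] to exchange labels with. *)
Lemma product_crossing_stars r s e f :
  1 < r -> r < s -> s <= #|B| -> e != f ->
  (exists2 M, M \in matchings dX r & e \in M) ->
  (exists2 M, M \in matchings dX s & f \in M) ->
  exists M N, [/\ M \in mstar dX r e, N \in mstar dX s f & [disjoint M & N]].
Proof.
move=> r_gt1 rs sB ef [M Mm eM] [N Nm fN].
have [n] := ubnP #|M :&: N|; elim: n => // n IHn in M Mm eM N Nm fN *; rewrite ltnS => leM.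
have [E0|[y /setIP[yM yN]]] := set_0Vmem (M :&: N).
  by exists M, N; rewrite !mem_mstar Mm Nm eM fN -setI_eq0 E0.
have [ye|ye] := eqVneq y e.
  have yf : y != f by rewrite ye.
  have [z] : exists z, z \in N :\: [set y; f].
    apply/card_gt0P; rewrite cardsD subn_gt0; have /matchingsP[_ ->] := Nm.
    rewrite (leq_ltn_trans (subset_leq_card (subsetIr _ _))) // cards2 yf.
    exact: leq_ltn_trans r_gt1 rs.
  rewrite !inE negb_or -andbA => /and3P[zy zf zN].
  have zly : p2 z != p2 y by apply: contraNneq zy => /(matching_p2_inj Nm zN yN)->.
  apply: (IHn M _ _ (relabel (tperm (p2 y) (p2 z)) @: N)) => //.
  - exact: relabel_matching.
  - apply: relabel_keep => //.
      by apply: contraNneq yf => /(matching_p2_inj Nm fN yN)->.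
    by apply: contraNneq zf => /(matching_p2_inj Nm fN zN)->.
  by apply: leq_trans leM; rewrite setIC [M :&: N]setIC proper_card // (relabel_disagree Nm Mm).
have [b] : exists b, b \in ~: (p2 @: M).
  apply/card_gt0P; rewrite cardsCs setCK subn_gt0 (leq_ltn_trans (leq_imset_card _ _)) //.
  by have /matchingsP[_ ->] := Mm; apply: leq_trans sB.
rewrite inE => bM; have notb (z : X) : z \in M -> p2 z != b.
  by move=> zM; apply: contraNneq bM => <-; apply: imset_f.
apply: (IHn (relabel (tperm (p2 y) b) @: M) _ _ N) => //.
- exact: relabel_matching.
- apply: relabel_keep => //; last exact: notb.
  by apply: contraNneq ye => /(matching_p2_inj Mm eM yM)->.
by apply: leq_trans leM; rewrite proper_card // (relabel_disagree Mm Nm) // eq_sym notb.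
Qed.

End Product.

(** * The cycle method for two parts *)

Lemma sum_periodic_shift (N i : nat) (f : nat -> nat) :
  (forall j, f (j + N) = f j) -> \sum_(0 <= j < N) f (i + j) = \sum_(0 <= j < N) f j.
Proof.
move=> fN; elim: i => [|i <-]; first exact: eq_bigr.
apply: (@addnI (f i)); rewrite -[X in f X + _ = _]addn0.
transitivity (\sum_(0 <= j < N.+1) f (i + j)).
  by rewrite big_nat_recl //; congr (_ + _); apply: eq_bigr => j _; rewrite addSnnS.
by rewrite big_nat_recr //= fN addnC.
Qed.

(** Katona's argument: after rotation 0 is chosen, and the other candidates pair up as [t] and
    [t + (N - r)], at most one of which is chosen. If each pair contributes, [r.*2 < N] lets a
    choice of the later one propagate to the next pair, so the chosen positions are consecutive. *)
Lemma katona_circle (N r : nat) (f : pred nat) :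
  0 < r -> r.*2 <= N -> (forall j, f (j + N) = f j) ->
  (forall i k, r <= k <= N - r -> f i -> ~~ f (i + k)) ->
  \sum_(0 <= j < N) f j <= r /\
  (r.*2 < N -> \sum_(0 <= j < N) f j = r -> exists a, forall k, k < r -> f (a + k)).
Proof.
move=> r_gt0 rN fN farf.
have [i0 fi0|nof] := pickP (fun i : 'I_N => f i); last first.
  rewrite big_nat_cond big1 => [|j]; last first.
    by rewrite andbT => /andP[_ jN]; have /= := nof (Ordinal jN); case: (f j).
  by split=> // _ r0; rewrite -r0 in r_gt0.
pose g j := f (i0 + j).
have -> : \sum_(0 <= j < N) f j = \sum_(0 <= j < N) g j.
  by rewrite -(@sum_periodic_shift N i0 f) // => j; rewrite fN.
have g0 : g 0 by rewrite /g addn0.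
have gfar j : r <= j <= N - r -> g j = false by move=> rj; apply/negbTE/farf.
have gpair t : 0 < t < r -> g t + g (t + (N - r)) <= 1.
  move=> tr; case gt: (g t) => //; last by case: (g _).
  have /negbTE : ~~ f (i0 + t + (N - r)) by apply: farf gt; lia.
  by rewrite -addnA => E; rewrite /g E.
have -> : \sum_(0 <= j < N) g j = 1 + \sum_(1 <= t < r) (g t + g (t + (N - r))).
  rewrite (@big_cat_nat _ _ _ 1) //=; last by lia.
  rewrite big_nat1 g0; congr (_ + _); rewrite (@big_cat_nat _ _ _ r) //=; last by lia.
  rewrite (@big_cat_nat _ _ _ (1 + (N - r)) r) /=; [|lia|lia].
  have -> : \sum_(r <= j < 1 + (N - r)) g j = 0.
    by rewrite big_nat_cond big1 // => j /andP[jr _]; rewrite gfar //; lia.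
  rewrite add0n big_split /=; congr (_ + _); rewrite big_addn.
  by rewrite (_ : N - (N - r) = r) //; lia.
have le1 : \sum_(1 <= t < r) (g t + g (t + (N - r))) <= \sum_(1 <= t < r) 1.
  by rewrite big_nat_cond [leqRHS]big_nat_cond; apply: leq_sum => t /andP[tr _]; apply: gpair.
have sum1 : \sum_(1 <= t < r) 1 = r - 1 by rewrite sum_nat_const_nat muln1.
split; first by rewrite sum1 in le1; lia.
move=> rN' sumE.
have gsum t : 0 < t < r -> g t + g (t + (N - r)) = 1.
  move=> tr; have : \sum_(1 <= t < r) (1 - (g t + g (t + (N - r)))) = 0.
    rewrite big_nat_cond sumnB; last by move=> u /andP[ur _]; apply: gpair.
    by rewrite -!big_nat_cond sum1; lia.
  move/eqP; rewrite sum_nat_seq_eq0 => /allP/(_ t).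
  by rewrite mem_index_iota tr => /(_ isT); have := gpair t tr; lia.
have step t : 0 < t -> t.+1 < r -> g (t + (N - r)) -> g (t.+1 + (N - r)).
  move=> t_gt0 tr gt; have := gsum t.+1; case gt1: (g t.+1); last first.
    by case: (g _) => // /(_ _); lia.
  have : ~~ f (i0 + t.+1 + (N - r - 1)) by apply: farf gt1; lia.
  have -> : i0 + t.+1 + (N - r - 1) = i0 + (t + (N - r)) by lia.
  by rewrite -/(g _) gt.
(* Position [r] is excluded, so the run from 0 stops at a first [t <= r]; the full run of [r]
   positions begins at [t + (N - r)]. *)
have exg : exists t, (0 < t <= r) && ~~ g t.
  by exists r; rewrite gfar //; lia.
have [t /andP[t_gt0 ngt] mint] := ex_minnP exg.
exists (i0 + (t + (N - r))) => k kr.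
have tail j : t + j < r -> g (t + j + (N - r)).
  elim: j => [|j IH] tj.
    by have := gsum t; rewrite (negbTE ngt) addn0; case: (g _) => // /(_ _); lia.
  by rewrite addnS; apply: step; [lia|lia|apply: IH; lia].
have [tk|tk] := ltnP (t + k) r.
  by have := tail k tk; rewrite /g; congr f; lia.
have -> : i0 + (t + (N - r)) + k = i0 + (t + k - r) + N by lia.
rewrite fN -/(g _); have [->|k_gt0] := posnP (t + k - r); first by [].
by apply/negPn/negP=> ngk; have := mint (t + k - r); rewrite ngk; lia.
Qed.

Lemma mod_eq_small n a b : a = b %[mod n] -> a <= b -> b - a < n -> a = b.
Proof.
move=> ab le_ab lt_n; have /eqP : b == a %[mod n] by rewrite ab.
move/eqP; rewrite eqn_mod_dvd // => /dvdn_leq; lia.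
Qed.

Lemma sub_in_interval w x r : w <= x < w + r -> x - w < r /\ w + (x - w) = x.
Proof. by lia. Qed.

(** The intervals are consecutive; [al] is how far the first reaches beyond [v], stopping short of
    [v + D]. *)
Lemma adjacent_intervals r v D : 0 < r <= v -> 0 < D < r.*2 ->
  exists w w', [/\ w <= v < w + r, w' <= v + D < w' + r &
    forall k l, w <= k < w + r -> w' <= l < w' + r -> k < l < k + r.*2].
Proof.
rewrite -addnn => rv Dr; pose al := minn D.-1 r.-1.
exists (v + al.+1 - r), (v + al.+1); split; [by rewrite /al; lia..|].
by move=> k l; rewrite /al; lia.
Qed.

(** * A cyclic order of the edges *)

Section Circle.
Variables (m n r : nat) (X : finType) (dX : rel X).
Variables (p1 : X -> 'I_m) (p2 : X -> 'I_n) (mk : 'I_m -> 'I_n -> X).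
Hypotheses (mk1 : forall e b, p1 (mk e b) = e) (mk2 : forall e b, p2 (mk e b) = b).
Hypothesis mkK : forall x, mk (p1 x) (p2 x) = x.
Hypothesis dXE : forall x y, dX x y = (p1 x != p1 y) && (p2 x != p2 y).
Hypotheses (r_gt0 : 0 < r) (rm : r < m) (mn : m <= n).

Let m_gt0 : 0 < m. Proof. by apply: leq_ltn_trans rm. Qed.
Let n_gt0 : 0 < n. Proof. by apply: leq_trans mn. Qed.

Definition col j : 'I_m := Ordinal (ltn_pmod j m_gt0).
Definition lab j : 'I_n := Ordinal (ltn_pmod (j %% m + j %/ m) n_gt0).
(* A cyclic enumeration of all edges in which any [r < m] consecutive ones are
   disjoint: the columns run cyclically, and the labels are shifted by one after
   each complete round. *)
Definition circ j : X := mk (col j) (lab j).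
Definition window j : {set X} := [set circ (j + k) | k : 'I_r].

Lemma circ_eq i j : (circ i = circ j) <-> (col i = col j /\ lab i = lab j).
Proof.
split=> [E|[c l]]; last by rewrite /circ c l.
by split; [move: (congr1 p1 E); rewrite !mk1|move: (congr1 p2 E); rewrite !mk2].
Qed.

(** A position is determined modulo [m * n] by its column and by its round modulo [n], and the
    latter can be read off from the label. *)
Lemma circ_mod i j : (circ i == circ j) = (i == j %[mod m * n]).
Proof.
apply/eqP/eqP=> [/circ_eq[/(congr1 val)/= c /(congr1 val)/= l]|E].
  move: l; rewrite c => /eqP; rewrite eqn_modDl => /eqP l.
  rewrite (divn_eq i m) (divn_eq j m) c; apply/eqP; rewrite eqn_modDr.
  by rewrite -!(mulnC m) -!muln_modr l.
suff P q t : circ (q * n * m + t) = circ t.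
  have {}P k : circ k = circ (k %% (m * n)).
    rewrite -(P (k %/ (m * n)) (k %% (m * n))); congr circ.
    by rewrite -mulnA (mulnC n) -divn_eq.
  by rewrite P E -P.
apply/circ_eq; split; apply: val_inj; rewrite /= modnMDl //.
by rewrite divnMDl // addnCA modnMDl.
Qed.

Lemma window_mod i j : i = j %[mod m * n] -> window i = window j.
Proof.
move=> ij; apply: eq_imset => k; apply/eqP.
by rewrite circ_mod eqn_modDr ij.
Qed.

(** The label is round plus column modulo [n]. One round later it recurs one column to the left,
    after [m - 1] steps, and two rounds later not before [2 m - 2] steps, which the bound
    excludes. *)
Lemma lab_eq i j : i < j -> j - i < m.*2 - 2 -> lab i = lab j ->
  j - i = m.-1 /\ (col i = (col j).+1 :> nat).
Proof.
move=> ij ji /(congr1 val)/=.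
have := divn_eq i m; have := divn_eq j m.
have := ltn_pmod i m_gt0; have := ltn_pmod j m_gt0.
move: (i %/ m) (j %/ m) (i %% m) (j %% m) => b b' c c' c'm cm jE iE l.
have lebb : b <= b'.
  by rewrite leqNgt; apply/negP=> lt; have := leq_mul lt (leqnn m); rewrite mulSn; lia.
have lebb3 : b' < b.+3.
  by rewrite ltnNge; apply/negP=> lt; have := leq_mul lt (leqnn m); rewrite !mulSn; lia.
have [E|[E|E]] : b' = b \/ b' = b.+1 \/ b' = b.+2 by lia.
- by rewrite E in jE l; have := mod_eq_small l; lia.
- rewrite E mulSn in jE l; have [lt|ge] := ltnP c'.+1 c.
    by have := mod_eq_small (esym l); lia.
  by have := mod_eq_small l; lia.
- by rewrite E !mulSn in jE l; have := mod_eq_small (esym l); lia.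
Qed.

Lemma col_eq i j : i < j -> j - i < m -> col i <> col j.
Proof.
by move=> ij ji /(congr1 val)/= E; have := mod_eq_small E (ltnW ij) ji; lia.
Qed.

Lemma mem_window j x :
  reflect (exists2 i, j <= i < j + r & x = circ i) (x \in window j).
Proof.
apply: (iffP imsetP) => [[k _ ->]|[i ji ->]].
  by exists (j + k) => //; have := ltn_ord k; lia.
have ir : i - j < r by lia.
by exists (Ordinal ir) => //=; congr circ; lia.
Qed.

(** Positions of a window differ by less than [r <= m - 1], too little for a column or a label to
    recur. *)
Lemma window_matching j : window j \in matchings dX r.
Proof.
have key i i' : j <= i -> i < i' -> i' < j + r -> col i != col i' /\ lab i != lab i'.
  move=> ji ii' i'j; split; apply/eqP; first by apply: col_eq; lia.
  by move=> /lab_eq[||]; lia.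
have keys i i' : j <= i < j + r -> j <= i' < j + r -> i != i' ->
    col i != col i' /\ lab i != lab i'.
  move=> ij i'j; rewrite neq_ltn => /orP[lt|lt]; first by apply: key; lia.
  by rewrite eq_sym [lab i == _]eq_sym; apply: key; lia.
apply/matchingsP; split.
  move=> _ _ /mem_window[i ij ->] /mem_window[i' i'j ->] ne; rewrite dXE !mk1 !mk2.
  by have [|-> ->] := keys i i' ij i'j; first by apply: contraNneq ne => ->.
rewrite card_imset ?card_ord // => k k' /circ_eq[c _]; apply/val_inj/eqP/negPn/negP=> kk'.
have [|||/eqP[]] // := keys (j + k) (j + k'); rewrite ?eqn_add2l //.
  by have := ltn_ord k; lia.
by have := ltn_ord k'; lia.
Qed.

Definition act (g : {perm 'I_m} * {perm 'I_n}) x := mk (g.1 (p1 x)) (g.2 (p2 x)).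

Lemma act_inj g : injective (act g).
Proof.
move=> x y E; rewrite -(mkK x) -(mkK y); congr mk.
  by move: (congr1 p1 E); rewrite !mk1 => /perm_inj.
by move: (congr1 p2 E); rewrite !mk2 => /perm_inj.
Qed.

Lemma act_comp g h x : act g (act h x) = act ((h.1 * g.1)%g, (h.2 * g.2)%g) x.
Proof. by rewrite /act !mk1 !mk2 !permM. Qed.

Let matching_inj1 M : M \in matchings dX r -> {in M &, injective p1}.
Proof.
case/matchingsP=> dM _ x y xM yM xy; apply/eqP/negP=> /negP/(dM x y xM yM).
by rewrite dXE xy eqxx.
Qed.

Let matching_inj2 M : M \in matchings dX r -> {in M &, injective p2}.
Proof.
case/matchingsP=> dM _ x y xM yM xy; apply/eqP/negP=> /negP/(dM x y xM yM).
by rewrite dXE xy eqxx andbF.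
Qed.

Lemma act_transitive M N :
  M \in matchings dX r -> N \in matchings dX r -> exists g, act g @: M = N.
Proof.
move=> Mm Nm; have um (L : {set X}) (T : eqType) (f : X -> T) :
    {in L &, injective f} -> uniq (map f (enum L)).
  move=> finj; rewrite map_inj_in_uniq ?enum_uniq // => x y.
  by rewrite !mem_enum; apply: finj.
have szMN : size (enum M) = size (enum N).
  by rewrite -!cardE; have /matchingsP[_ ->] := Mm; have /matchingsP[_ ->] := Nm.
have [|g1 E1] := perm_extend (um _ _ _ (matching_inj1 Mm)) (um _ _ _ (matching_inj1 Nm)).
  by rewrite !size_map.
have [|g2 E2] := perm_extend (um _ _ _ (matching_inj2 Mm)) (um _ _ _ (matching_inj2 Nm)).
  by rewrite !size_map.
exists (g1, g2); have E : map (act (g1, g2)) (enum M) = enum N.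
  apply: (inj_map (f := fun x => (p1 x, p2 x))).
    by move=> x y [E3 E4]; rewrite -(mkK x) -(mkK y) E3 E4.
  rewrite -map_comp -[LHS]zip_unzip -[RHS]zip_unzip /unzip1 /unzip2 -!map_comp.
  congr zip; [move: E1|move: E2]; rewrite -map_comp => <-; apply: eq_map => x /=;
    by rewrite ?mk1 ?mk2.
apply/setP=> x; rewrite -(mem_enum N) -E; apply/imsetP/mapP=> -[y yM ->];
  by exists y; rewrite ?mem_enum // mem_enum in yM *.
Qed.

Definition placements M :=
  #|[set t : ({perm 'I_m} * {perm 'I_n}) * 'I_(m * n) | act t.1 @: window t.2 == M]|.

Lemma placements_const M N :
  M \in matchings dX r -> N \in matchings dX r -> placements M = placements N.
Proof.
move=> Mm Nm; apply/eqP; rewrite eqn_leq; move: M N Mm Nm.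
suff le M N : M \in matchings dX r -> N \in matchings dX r -> placements M <= placements N.
  by move=> M N Mm Nm; rewrite !le.
move=> Mm Nm; have [g gE] := act_transitive Mm Nm.
pose f (t : ({perm 'I_m} * {perm 'I_n}) * 'I_(m * n)) :=
  (((t.1.1 * g.1)%g, (t.1.2 * g.2)%g), t.2).
have finj : injective f.
  by move=> [[a b] i] [[a' b'] i'] [/mulIg-> /mulIg-> ->].
rewrite /placements -(card_imset _ finj); apply: subset_leq_card.
apply/subsetP=> _ /imsetP[t + ->]; rewrite !inE => /eqP tE.
rewrite -gE -tE -imset_comp; apply/eqP/eq_imset => x /=.
by rewrite act_comp.
Qed.

Lemma sum_placements (F : {set {set X}}) M :
  F \subset matchings dX r -> M \in matchings dX r ->
  \sum_(g : {perm 'I_m} * {perm 'I_n})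
     \sum_(0 <= j < m * n) (act g @: window j \in F : nat) = placements M * #|F|.
Proof.
move=> sF Mm.
transitivity (\sum_(t : ({perm 'I_m} * {perm 'I_n}) * 'I_(m * n) |
    act t.1 @: window t.2 \in F) 1).
  rewrite [RHS]big_mkcond /=; rewrite (eq_bigr (fun g =>
    \sum_(j < m * n) (act g @: window j \in F : nat))); last first.
    by move=> g _; rewrite big_mkord.
  by rewrite pair_bigA /=; apply: eq_bigr => t _; case: (_ \in _).
rewrite (partition_big
  (fun t : ({perm 'I_m} * {perm 'I_n}) * 'I_(m * n) => act t.1 @: window t.2) (mem F)) //=.
rewrite [RHS]mulnC -sum_nat_const; apply: eq_bigr => N NF.
rewrite (placements_const Mm (subsetP sF N NF)) /placements -sum1_card.
apply: eq_bigl => t; rewrite inE; case: eqP => [->|_]; rewrite ?NF ?andbF //.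
Qed.

Lemma card_edges : #|X| = m * n.
Proof.
rewrite -[m]card_ord -[n]card_ord -card_prod.
apply: (@bij_eq_card _ _ (fun x => (p1 x, p2 x))).
exists (fun e => mk e.1 e.2) => [x|[a b]]; by rewrite /= ?mkK ?mk1 ?mk2.
Qed.

Variable s : nat.
Hypothesis star_s : forall x, #|mstar dX r x| = s.

(** Two double counts, of the windows on all circles and of the edges in all matchings, from which
    the number of matchings is eliminated. Hence an average of [r] windows per circle corresponds to
    a family of size [s]. *)
Lemma placements_star M : M \in matchings dX r ->
  0 < placements M /\
  placements M * s = r * #|{: {perm 'I_m} * {perm 'I_n}}|.
Proof.
move=> Mm; set G := #|_|.
have G_gt0 : 0 < G by apply/card_gt0P; exists (1%g, 1%g).
have N_gt0 : 0 < m * n by rewrite muln_gt0 m_gt0.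
have all_windows : placements M * #|matchings dX r| = m * n * G.
  rewrite -(sum_placements (subxx _) Mm) -[G]sum1_card big_distrr /=.
  apply: eq_bigr => g _; rewrite muln1 -[RHS]subn0 -[RHS]muln1 -sum_nat_const_nat.
  apply: eq_bigr => j _; suff -> : act g @: window j \in matchings dX r by [].
  have /matchingsP[dW cW] := window_matching j; apply/matchingsP.
  rewrite card_imset //; last exact: act_inj.
  split=> // _ _ /imsetP[x xW ->] /imsetP[y yW ->] xy.
  have := dW x y xW yW; rewrite !dXE !mk1 !mk2 !(inj_eq perm_inj); apply.
  by apply: contraNneq xy => ->.
have count_incidences : m * n * s = r * #|matchings dX r|.
  rewrite -card_edges -sum_nat_const mulnC -sum_nat_const.
  rewrite (eq_bigr (fun x => \sum_(N in matchings dX r) (x \in N))); last first.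
    move=> x _; rewrite -(star_s x) -sum1_card big_mkcond [RHS]big_mkcond /=.
    by apply: eq_bigr => N _; rewrite mem_mstar; case: (_ \in _); case: (_ \in _).
  rewrite exchange_big /=; apply: eq_bigr => N /matchingsP[_ <-].
  by rewrite -sum1_card [RHS]big_mkcond; apply: eq_bigr => x _; case: (_ \in _).
split.
  rewrite lt0n; apply/eqP=> p0; move: all_windows; rewrite p0 mul0n.
  by move/esym/eqP; rewrite muln_eq0 !gtn_eqF.
apply/eqP; rewrite -(eqn_pmul2l N_gt0); apply/eqP.
by rewrite mulnCA count_incidences mulnCA all_windows mulnCA.
Qed.

(** * Intersecting families on the circles *)

Section IntersectingOnCircles.
Variable F : {set {set X}}.
Hypotheses (sF : F \subset matchings dX r) (mF : meets F).

Let f g j := act g @: window j \in F.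

Lemma circle_mod g i j : i = j %[mod m * n] -> f g i = f g j.
Proof. by move=> ij; rewrite /f (window_mod ij). Qed.

Lemma size_circle : (r.+1) ^ 2 <= m * n.
Proof. by rewrite -mulnn leq_mul // (leq_trans rm). Qed.

Lemma windows_meet g h i j : f g i -> f h j ->
  exists k l, [/\ i <= k < i + r, j <= l < j + r & act g (circ k) = act h (circ l)].
Proof.
move=> fi fj; have [x [/imsetP[y /mem_window[k ik ->] ->]]] := mF fi fj.
by case/imsetP=> z /mem_window[l jl ->] E; exists k, l.
Qed.

(** Windows at distance between [r] and [m * n - r] are disjoint since [circ] is injective modulo
    [m * n]; [size_circle] makes the circle longer than [2 r]. *)
Lemma circle_katona g :
  \sum_(0 <= j < m * n) f g j <= r /\
  (\sum_(0 <= j < m * n) f g j = r -> exists a, forall k, k < r -> f g (a + k)).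
Proof.
have rN := size_circle; have [|//|j|i k ik fi|le_r eq_r] := @katona_circle (m * n) r (f g).
- exact: r_gt0.
- by rewrite -addnn; lia.
- by apply: circle_mod; rewrite modnDr.
- apply/negP=> fik; have [u [v [iu ikv /act_inj/eqP]]] := windows_meet fi fik.
  rewrite circ_mod => /eqP/mod_eq_small => /(_ _ _)E; lia.
by split=> // /eq_r; apply; rewrite -addnn; lia.
Qed.

Lemma circle_bound : #|F| <= s.
Proof.
have [F0|[M MF]] := set_0Vmem F; first by rewrite F0 cards0.
have Mm := subsetP sF M MF; have [p_gt0 pE] := placements_star Mm.
rewrite -(leq_pmul2l p_gt0) pE -(sum_placements sF Mm) -sum1_card big_distrr /=.
by apply: leq_sum => g _; rewrite muln1; case: (circle_katona g).
Qed.

Hypotheses (cF : #|F| = s) (s_gt0 : 0 < s) (r_gt2 : 2 < r).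

(** [j + k = u] with [k < r] says that the window starting at [j] covers the position [u] on the
    circle. *)
Definition circle_star g u := forall j k, k < r -> j + k = u %[mod m * n] -> f g j.

Lemma circle_star_exists g : exists u, circle_star g u.
Proof.
have /card_gt0P[M MF] : 0 < #|F| by rewrite cF.
have Mm := subsetP sF M MF; have [p_gt0 pE] := placements_star Mm.
have sum_eq : \sum_g \sum_(0 <= j < m * n) f g j = r * #|{: {perm 'I_m} * {perm 'I_n}}|.
  by rewrite (sum_placements sF Mm) cF pE.
have [_ +] := circle_katona g; case.
  have : \sum_g (r - \sum_(0 <= j < m * n) f g j) = 0.
    rewrite sumnB => [|h _]; last by case: (circle_katona h).
    by rewrite sum_eq sum_nat_const mulnC subnn.
  move/eqP; rewrite sum_nat_eq0 => /forallP/(_ g)/=; rewrite subn_eq0 => ge_r.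
  by apply/eqP; rewrite eqn_leq ge_r andbT; case: (circle_katona g).
(* Equality in the average gave [r] consecutive windows; the last starting position lies in all of
   them, and every window through it is one of them. *)
move=> a fa; exists (a + r.-1) => j k kr jk.
rewrite (@circle_mod g j (a + (r.-1 - k))); first by apply: fa; lia.
apply/eqP; rewrite -(eqn_modDr k) jk; apply/eqP; congr (_ %% _); lia.
Qed.

Definition swap_col (p q : 'I_m) (g : {perm 'I_m} * {perm 'I_n}) :
  {perm 'I_m} * {perm 'I_n} := ((tperm p q * g.1)%g, g.2).

Lemma act_swap p q g k l : act g (circ k) = act (swap_col p q g) (circ l) ->
  col k = tperm p q (col l) /\ lab k = lab l.
Proof.
move=> E; move: (congr1 p1 E) (congr1 p2 E); rewrite /act /swap_col /= !mk1 !mk2.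
by rewrite permM => /perm_inj-> /perm_inj->.
Qed.

(** Within [2 r] steps equal labels occur only in adjacent columns, while [p] and [q] are not
    adjacent. *)
Lemma no_swap_near (p q : 'I_m) k l :
  (p.+1 < q) || (q.+1 < p) -> k < l < k + r.*2 -> lab k = lab l ->
  col k != tperm p q (col l).
Proof.
move=> pq kl /lab_eq[||_ ck]; [lia|by rewrite -!addnn; lia|].
apply/eqP=> E; move: ck; rewrite {}E; case: tpermP => [->|->|_ _]; lia.
Qed.

(** [a] is the last position in column [c] before [u], at distance [t]; the window starts after [a]
    and, as [r < m], ends before the column returns. *)
Lemma window_avoiding_col u (c : 'I_m) : m * n <= u -> col u != c ->
  exists2 w, w <= u < w + r & forall k, w <= k < w + r -> col k != c.
Proof.
move=> leu uc; pose t := (u + (m - c)) %% m.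
have c_lt := ltn_ord c; have t_lt : t < m by rewrite ltn_pmod.
have m_le : m <= m * n by rewrite leq_pmulr.
have [a [ua ac]] : exists a, u = a + t /\ a %% m = c.
  exists (u - t); split; first by lia.
  have E : (u - t) + (m - c) = 0 %[mod m].
    apply/eqP; rewrite -(eqn_modDr t) add0n addnAC subnK ?modn_mod //; lia.
  have : (u - t) + (m - c) + c = 0 + c %[mod m].
    by apply/eqP; rewrite eqn_modDr E.
  by rewrite -addnA subnK ?modnDr ?add0n ?(modn_small c_lt) // ltnW.
have t_gt0 : 0 < t.
  rewrite lt0n; apply: contra_neq uc => t0; apply: val_inj.
  by rewrite /= ua t0 addn0.
exists (u.+1 - minn t r); first by lia.
move=> k wk; apply/eqP=> /(congr1 val)/=; rewrite -ac => /esym E.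
by have := mod_eq_small E; lia.
Qed.

(* If the common position moved by [D], then nearby windows ([D < 2 r]) can be chosen
   adjacent, where no label occurs in both columns, and distant ones
   avoiding one of the two columns; both pairs of windows would be disjoint. *)
Lemma circle_star_swap g u (p q : 'I_m) :
  circle_star g u -> p != col u -> q != col u ->
  (p.+1 < q) || (q.+1 < p) -> circle_star (swap_col p q g) u.
Proof.
move=> star_u pu qu pq; have [u' star_u'] := circle_star_exists (swap_col p q g).
set N := m * n in star_u star_u'; have N_gt0 : 0 < N by rewrite muln_gt0 m_gt0.
have rN : r.+1 ^ 2 <= N := size_circle.
(* The distance from [u] to [u'] around the circle; [N * u - u] stands for minus [u]. Adding [N] in
   [v] leaves room for windows that start earlier. *)
pose D := (u' + (N * u - u)) %% N.
have D_lt : D < N by rewrite ltn_pmod.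
pose v := u + N.
have vD : v + D = u' %[mod N].
  rewrite /v /D addnAC modnDr modnDmr addnCA subnKC; last by rewrite leq_pmull.
  by rewrite addnC mulnC modnMDl.
have vu : v = u %[mod N] by rewrite modnDr.
have colv : col v = col u by apply: val_inj; rewrite /= /v /N mulnC addnC modnMDl.
have [D0|D_gt0] := posnP D.
  move=> j k kr jk; apply: (star_u' j k kr); rewrite -vD D0 addn0 vu; exact: jk.
have hit x y w w' : x = u %[mod N] -> y = u' %[mod N] ->
    w <= x < w + r -> w' <= y < w' + r ->
    exists k l, [/\ w <= k < w + r, w' <= l < w' + r,
      col k = tperm p q (col l) & lab k = lab l].
  move=> xu yu' wx w'y; have fw : f g w.
    have [lt E] := sub_in_interval wx.
    by apply: (star_u w (x - w) lt); rewrite E.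
  have fw' : f (swap_col p q g) w'.
    have [lt E] := sub_in_interval w'y.
    by apply: (star_u' w' (y - w') lt); rewrite E.
  have [k [l [wk w'l /act_swap[c lb]]]] := windows_meet fw fw'.
  by exists k, l.
have leNv : N <= v by rewrite leq_addl.
have ler_v : 0 < r <= v.
  rewrite r_gt0 (leq_trans _ leNv) // (leq_trans _ rN) //.
  by rewrite (leq_trans (leqnSn r)) // -{1}[r.+1]expn1 leq_pexp2l.
have [D_small|D_big] := ltnP D r.*2.
  have [|w [w' [wv w'v near]]] := adjacent_intervals ler_v (_ : 0 < D < _).
    by rewrite D_gt0 D_small.
  have [k [l [wk w'l c lb]]] := hit _ _ w w' vu vD wv w'v.
  by have := no_swap_near pq (near k l wk w'l) lb; rewrite c eqxx.
have vN : v + D + (N - D) = u %[mod N] by rewrite -addnA subnKC 1?ltnW // modnDr.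
have [D_large|D_mid] := ltnP (N - D) r.*2.
  have [||w' [w [w'v wv near]]] := @adjacent_intervals r (v + D) (N - D).
  - by case/andP: ler_v => -> /leq_trans; apply; rewrite leq_addr.
  - by rewrite subn_gt0 D_lt.
  have [k [l [wk w'l c lb]]] := hit _ _ w w' vN vD wv w'v.
  by have := no_swap_near pq (near l k w'l wk) (esym lb); rewrite c tpermK eqxx.
(* One of [p] and [q] is the column of neither position. If both windows avoid it, the transposition
   does not move a common edge, whose two positions would then agree modulo [N], although the
   windows are too far apart. *)
have [c0 [c0pq c0v c0vD]] : exists c0, [/\ c0 = p \/ c0 = q, col v != c0 & col (v + D) != c0].
  have [Ep|Ep] := eqVneq (col (v + D)) p; last by exists p; rewrite colv eq_sym Ep; split=> //; left.
  exists q; rewrite colv eq_sym Ep; split=> //; first by right.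
  by apply/eqP=> pqE; rewrite pqE in pq; lia.
have [w wv wc] := window_avoiding_col leNv c0v.
have [w' w'v w'c] := window_avoiding_col (leq_trans leNv (leq_addr _ _)) c0vD.
have [k [l [wk w'l c lb]]] := hit _ _ w w' vu vD wv w'v.
have ck := wc k wk; have cl := w'c l w'l.
suff ckl : col k = col l.
  have /eqP : circ k = circ l by apply/circ_eq.
  rewrite circ_mod -/N => /eqP kl; move: wk w'l wv w'v D_big D_mid D_lt.
  move: (mod_eq_small kl); clear -r_gt0; rewrite -!addnn => kl wk w'l wv w'v D1 D2 D3.
  by have := kl _ _; lia.
move: c ck; case: tpermP => // [lp|lq] ->; move: cl; rewrite ?lp ?lq;
  by case: c0pq => ->; rewrite eqxx.
Qed.

(* Start from a window through the common position [u] of the windows in [F]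
   and transpose columns so as to shrink its intersection with [M]. Columns [x]
   and [z] can be exchanged when [x <= z - 2], so the window is chosen to avoid
   column [z - 1]. *)
Lemma circle_star_unique : exists e, forall M, M \in F -> e \in M.
Proof.
have [u0 star_u0] := circle_star_exists (1%g, 1%g).
pose u := u0 + m * n; have leNu : m * n <= u by rewrite leq_addl.
have star_u : circle_star (1%g, 1%g) u.
  by move=> j k kr jk; apply: (star_u0 j k kr); rewrite jk /u modnDr.
(* [z] is the last column other than [l]. *)
set l := col u; pose z := if l == m.-1 :> nat then m - 2 else m.-1.
have l_lt := ltn_ord l.
have z_lt : z < m by rewrite /z; case: ifP => _; lia.
have [w wu wz] : exists2 w, w <= u < w + r &
    forall k, w <= k < w + r -> k != u -> (col k).+1 != z.
  (* If [z - 1] is the column [l] of [u] itself, the window starts at [u] and ends before this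
     column recurs. *)
  have [lz|lz] := eqVneq (l.+1) z.
    exists u; first by lia.
    move=> k uk ku; rewrite -lz eqSS; apply/eqP=> /val_inj/esym.
    by apply: col_eq; lia.
  have z1_lt : z.-1 < m by lia.
  have [|w wu wc] := @window_avoiding_col u (Ordinal z1_lt) leNu.
    by apply: contra_neq lz => /(congr1 val)/= ->; rewrite prednK // /z; case: ifP; lia.
  exists w => // k /wc kz _; apply: contra_neq kz => kz.
  by apply: val_inj; rewrite /= -kz.
exists (circ u) => M MF; have Mm := subsetP sF M MF.
(* These conditions keep the edge at position [u] equal to [circ u] while the circle is changed. *)
have [g [gl g2 star_g]] : exists g : {perm 'I_m} * {perm 'I_n},
  [/\ g.1 l = l, g.2 = 1%g & circle_star g u] by exists (1%g, 1%g); rewrite perm1.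
have [k] := ubnP #|act g @: window w :&: M|; elim: k => // k IHk in g gl g2 star_g *.
rewrite ltnS => le_k.
have fw : f g w by apply: (star_g w (u - w)); rewrite ?subnKC //; lia.
have [x [/imsetP[y /mem_window[i wi ->] {x y}->] iM]] := mF fw MF.
have [iu|iu] := eqVneq i u.
  by move: iM; rewrite iu /act g2 perm1 !mk1 mk2 -/l gl.
have il : col i != l.
  apply/eqP; move: iu; rewrite neq_ltn => /orP[lt|lt]; first by apply: col_eq; lia.
  by move/esym; apply: col_eq; lia.
have iz := wz i wi iu; have i_lt := ltn_ord (col i).
(* Column [col i] is exchanged with [z] or, if it is [z] itself, with the first column other than
   [l]; by [iz] or by [m >= 4] the two are at least two apart. *)
have [c [cl ci]] : exists c : 'I_m, c != l /\ ((col i).+1 < c) || (c.+1 < col i).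
  have lE : (col i != l :> nat) by [].
  have zP : (l = m.-1 :> nat /\ z = m - 2) \/ (l <> m.-1 :> nat /\ z = m.-1).
    by rewrite /z; case: eqP; [left|right].
  have rm' : 2 < m by apply: ltn_trans rm.
  clear -zP lE iz i_lt l_lt rm rm' r_gt2 z_lt.
  move: {i}(col i) iz i_lt lE => c0 iz i_lt lE; clearbody l z.
  have [Ez|Nz] := eqVneq (c0 : nat) z.
    have c_lt : (l == 0 :> nat) < m by case: (_ == _); lia.
    have [c cE] : exists c : 'I_m, c = (l == 0 :> nat) :> nat by exists (Ordinal c_lt).
    exists c; split; first by apply/eqP=> cl; move: cE; rewrite cl; case: eqP; lia.
    by apply/orP; right; rewrite cE; case: eqP; lia.
  exists (Ordinal z_lt); split; first by apply/eqP=> /(congr1 val)/=; lia.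
  by apply/orP; left; rewrite /=; lia.
have star_g' : circle_star (swap_col (col i) c g) u by apply: circle_star_swap.
apply: (IHk (swap_col (col i) c g)) => //.
  by rewrite /= permM tpermD // eq_sym.
apply: leq_trans le_k; apply: proper_card.
(* Transposing columns before [g] is transposing their images after it: a [relabel] with the two
   parts interchanged. *)
have -> : act (swap_col (col i) c g) @: window w =
    relabel p2 p1 (fun b e => mk e b) (tperm (g.1 (col i)) (g.1 c)) @: (act g @: window w).
  rewrite -imset_comp; apply: eq_imset => y.
  by rewrite /relabel /act /swap_col /= !mk1 !mk2 permM -inj_tperm //; apply: perm_inj.
have actm : act g @: window w \in matchings dX r := subsetP sF _ fw.
have := @relabel_disagree 'I_n 'I_m X (fun x y => x != y) dX p2 p1 (fun b e => mk e b)
  _ _ _ _ _ r r _ M (act g (circ i)) (g.1 c) actm Mm _ iM _.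
rewrite [p1 _]mk1 [p1 _]mk1; apply.
- by move=> e b; apply: mk2.
- by move=> e b; apply: mk1.
- by move=> x; apply: mkK.
- by move=> x y; rewrite dXE andbC.
- by move=> x; rewrite eqxx.
- by apply/imset_f/mem_window; exists i.
by rewrite (inj_eq perm_inj); apply/eqP=> E; move: ci; rewrite E; lia.
Qed.

End IntersectingOnCircles.
End Circle.

(** * Induction on the number of parts *)

Section PeelLastCoordinate.
Variables (k : nat) (n : 'I_k.+1 -> nat).

(** Dropping the last part keeps the smallest, [ord0], present throughout the induction. *)
Definition edge_init (e : edge n) : edge (fun i : 'I_k => n (lift ord_max i)) :=
  [ffun i => e (lift ord_max i)].

Definition edge_last (e : edge n) : 'I_(n ord_max) := e ord_max.

(** The casts follow the index equalities from [unliftP], since the size of a part depends on its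
    index; they leave the underlying number unchanged. *)
Definition edge_rcons (e : edge (fun i : 'I_k => n (lift ord_max i)))
    (b : 'I_(n ord_max)) : edge n :=
  [ffun i => match unliftP ord_max i with
             | UnliftSome j ij => cast_ord (congr1 n (esym ij)) (e j)
             | UnliftNone ij => cast_ord (congr1 n (esym ij)) b
             end].

Lemma edge_init_rcons e b : edge_init (edge_rcons e b) = e.
Proof.
apply/ffunP=> i; rewrite !ffunE; apply: val_inj.
case: unliftP => [j ij|ij]; last by have := neq_lift ord_max i; rewrite {1}ij eqxx.
by rewrite /=; congr (val (e _)); apply/esym/(@lift_inj _ ord_max).
Qed.

Lemma edge_last_rcons e b : edge_last (edge_rcons e b) = b.
Proof.
rewrite /edge_last ffunE; apply: val_inj.
by case: unliftP => [j ij|//]; exfalso; have := neq_lift ord_max j; rewrite -ij eqxx.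
Qed.

Lemma edge_rconsK e : edge_rcons (edge_init e) (edge_last e) = e.
Proof.
apply/ffunP=> i; rewrite ffunE; apply: val_inj.
by case: unliftP => [j ij|ij]; rewrite /= ?ffunE /edge_last; congr (val (e _)).
Qed.

Lemma vdisjoint_peel (e f : edge n) :
  vdisjoint e f = vdisjoint (edge_init e) (edge_init f) && (edge_last e != edge_last f).
Proof.
apply/forallP/andP=> [ef|[/forallP ef ef_last] i].
  by split; [apply/forallP=> i; rewrite !ffunE|]; apply: ef.
case: (unliftP ord_max i) => [j ->|-> //].
by have := ef j; rewrite !ffunE.
Qed.

End PeelLastCoordinate.

Lemma vdisjoint_irr k (n : 'I_k.+1 -> nat) : irreflexive (@vdisjoint _ n).
Proof. by move=> e; apply/negbTE/forallPn; exists ord0; rewrite negbK. Qed.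

Lemma card_mstar_neq (E : finType) (d : rel E) r e :
  (forall x y, d x y = (x != y)) -> 0 < r -> #|mstar d r e| = 'C(#|E|.-1, r.-1).
Proof.
move=> dE r_gt0.
have <- : #|[set~ e]| = #|E|.-1 by rewrite cardsC1.
rewrite -cards_draws -[RHS](card_in_imset (f := fun A => e |: A)).
  apply: eq_card => M; rewrite mem_mstar; apply/andP/imsetP=> [[/matchingsP[_ cM] eM]|].
    exists (M :\ e); last by rewrite setD1K.
    rewrite inE; apply/andP; split; last by rewrite -cM (cardsD1 e M) eM.
    by apply/subsetP=> x; rewrite !inE => /andP[].
  case=> A; rewrite inE => /andP[sA /eqP cA] ->; rewrite setU11; split=> //.
  apply/matchingsP; split; first by move=> x y _ _; rewrite dE.
  rewrite cardsU1 cA; have -> : e \notin A.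
    by apply/negP=> /(subsetP sA); rewrite !inE eqxx.
  by rewrite add1n prednK.
move=> A A'; rewrite !inE => /andP[sA _] /andP[sA' _] /= AA'.
have P (B : {set E}) : B \subset [set~ e] -> (e |: B) :\ e = B.
  move=> sB; apply/setP=> x; rewrite !inE; case: eqP => //= ->.
  by apply/esym/negP=> /(subsetP sB); rewrite !inE eqxx.
by rewrite -(P A sA) AA' P.
Qed.

Lemma vdisjoint1 (n : 'I_1 -> nat) (e f : edge n) : vdisjoint e f = (e != f).
Proof.
apply/forallP/idP=> [/(_ ord0)|ef i]; first by apply: contra_neq => ->.
apply: contra_neq ef => ef; apply/ffunP=> j.
by rewrite (ord1 j) -(ord1 i).
Qed.

Lemma edge1_inj (n : 'I_1 -> nat) : injective (fun e : edge n => e ord0).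
Proof. by move=> e f ef; apply/ffunP=> j; rewrite (ord1 j). Qed.

Definition edge1 (n : 'I_1 -> nat) (a : 'I_(n ord0)) : edge n :=
  [ffun i => cast_ord (congr1 n (esym (ord1 i))) a].

Lemma edge1E (n : 'I_1 -> nat) (a : 'I_(n ord0)) : edge1 a ord0 = a.
Proof. by rewrite ffunE; apply: val_inj. Qed.

Lemma card_edge1 (n : 'I_1 -> nat) : #|edge n| = n ord0.
Proof.
rewrite -[RHS]card_ord; apply: (@bij_eq_card _ _ (fun e : edge n => e ord0)).
by exists (@edge1 n) => [e|a]; [apply: edge1_inj|]; rewrite edge1E.
Qed.

Lemma star_bound_full (E : finType) (d : rel E) :
  (forall x y, d x y = (x != y)) -> 0 < #|E| -> star_bound d #|E| 1.
Proof.
move=> dE E_gt0; split=> [e|F sF _]; first by rewrite card_mstar_neq // binn.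
rewrite -(cards1 [set: E]); apply/subset_leq_card/subsetP=> M /(subsetP sF).
case/matchingsP=> _ cM; rewrite inE eqEcard subsetT cM cardsT.
by rewrite leqnn.
Qed.

Section TwoParts.
Variables (n : 'I_2 -> nat).
Let n' := fun i : 'I_1 => n (lift ord_max i).

Definition edge_first (e : edge n) : 'I_(n' ord0) := edge_init e ord0.
Definition edge_pair (a : 'I_(n' ord0)) b : edge n := edge_rcons (edge1 a) b.

Lemma edge_first_pair a b : edge_first (edge_pair a b) = a.
Proof. by rewrite /edge_first /edge_pair edge_init_rcons edge1E. Qed.

Lemma edge_last_pair a b : edge_last (edge_pair a b) = b.
Proof. exact: edge_last_rcons. Qed.

Lemma edge_pairK e : edge_pair (edge_first e) (edge_last e) = e.
Proof.
rewrite -[RHS]edge_rconsK; congr edge_rcons; apply: edge1_inj; exact: edge1E.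
Qed.

Lemma vdisjoint_pair e f :
  vdisjoint e f = (edge_first e != edge_first f) && (edge_last e != edge_last f).
Proof. by rewrite vdisjoint_peel vdisjoint1 -(inj_eq (@edge1_inj n')). Qed.

End TwoParts.

(** The induction starts at two parts, because with one part and [r < n ord0 < 2 r] all [r]-subsets
    meet and outnumber a star. At two parts [r < n ord0] is left to the cycle method, while for
    [r = n ord0] every trace is the whole first part. The first equation is the bound cleared of its
    division. *)
Lemma edge_star_theorem k (n : 'I_k.+2 -> nat) r :
  0 < r -> (forall i, r <= n i) -> (forall i, n ord0 <= n i) ->
  exists s, [/\ s * (r.-1)`! = \prod_i (n i).-1 ^_ r.-1,
    star_bound (@vdisjoint _ n) r s & star_unique (@vdisjoint _ n) r s].
Proof.
move=> r_gt0; elim: k n => [|k IHk] n rn n0; set n' := fun i => n (lift ord_max i).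
  have n'0 : n' ord0 = n ord0 by rewrite /n'; congr n; apply: val_inj.
  have cE : #|edge n'| = n ord0 by rewrite card_edge1.
  have rB : 0 < r <= #|'I_(n ord_max)| by rewrite r_gt0 card_ord rn.
  have cards := product_star_card (@edge_init_rcons _ n) (@edge_last_rcons _ n)
    (@edge_rconsK _ n) (@vdisjoint_peel _ n) (@vdisjoint_irr _ n') rB
    (fun e => card_mstar_neq e (@vdisjoint1 n') r_gt0).
  rewrite cE card_ord in cards; set s := _ * _ in cards.
  exists s; split.
  - rewrite big_ord_recr big_ord1 /= /s mulnAC bin_ffact; congr (_ ^_ _ * _).
    by congr (n _).-1; apply: val_inj.
  - have := rn ord0; rewrite leq_eqVlt => /predU1P[rE|ltr].
      have := product_star_bound (@edge_init_rcons _ n) (@edge_last_rcons _ n)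
        (@edge_rconsK _ n) (@vdisjoint_peel _ n) (@vdisjoint_irr _ n') rB.
      move=> /(_ 1); rewrite card_ord /s rE binn; apply.
      have := star_bound_full (@vdisjoint1 n'); rewrite cE; apply.
      by rewrite -rE.
    split=> // F sF mF; apply: (circle_bound (@edge_first_pair n) (@edge_last_pair n)
      (@edge_pairK n) (@vdisjoint_pair n) r_gt0 _ _ cards sF mF); rewrite -/(n' _) n'0 //.
  have sE : s = 'C((n ord0).-1, r.-1) * (n ord_max).-1 ^_ r.-1 by [].
  clearbody s; have [r1|[r2|r_gt2]] : r = 1 \/ r = 2 \/ 2 < r by lia.
  - by rewrite r1; apply: star_unique1.
  - rewrite r2 in cards *; exact: (product_star_unique2 (@edge_init_rcons _ n)
      (@edge_last_rcons _ n) (@vdisjoint_peel _ n) (@vdisjoint_irr _ n') cards).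
  have := rn ord0; rewrite leq_eqVlt => /predU1P[rE|ltr]; last first.
    move=> F sF mF cF s_gt0.
    apply: (circle_star_unique (@edge_first_pair n) (@edge_last_pair n)
      (@edge_pairK n) (@vdisjoint_pair n) r_gt0 _ _ cards sF mF cF s_gt0) => //;
      by rewrite -/(n' _) n'0.
  have rB2 : 2 < r <= #|'I_(n ord_max)| by rewrite r_gt2 card_ord rn.
  have := product_star_unique_gt2 (@edge_init_rcons _ n) (@edge_last_rcons _ n)
    (@edge_rconsK _ n) (@vdisjoint_peel _ n) (@vdisjoint_irr _ n') rB2.
  move=> /(_ 1); rewrite card_ord sE rE binn; apply.
  have := star_bound_full (@vdisjoint1 n'); rewrite cE; apply.
  by rewrite -rE.
have [i|i|s [sE bnd _]] := IHk n'; first exact: rn.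
  by have -> : n' ord0 = n ord0; [rewrite /n'; congr n; apply: val_inj|apply: n0].
have rB : 0 < r <= #|'I_(n ord_max)| by rewrite r_gt0 card_ord rn.
exists (s * (n ord_max).-1 ^_ r.-1); split.
- rewrite mulnAC sE [RHS]big_ord_recr /=; congr (_ * _); apply: eq_bigr => i _.
  by rewrite /n'; congr ((n _).-1 ^_ _); apply/val_inj/lift_max.
- rewrite -[n ord_max]card_ord.
  exact: (product_star_bound (@edge_init_rcons _ n) (@edge_last_rcons _ n)
    (@edge_rconsK _ n) (@vdisjoint_peel _ n) (@vdisjoint_irr _ n') rB bnd).
clear IHk sE; have [r1|[r2|r_gt2]] : r = 1 \/ r = 2 \/ 2 < r by lia.
- by rewrite r1; apply: star_unique1.
- rewrite r2 in bnd rB *; apply: (product_star_unique2 (@edge_init_rcons _ n)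
    (@edge_last_rcons _ n) (@vdisjoint_peel _ n) (@vdisjoint_irr _ n')).
  rewrite -[n ord_max]card_ord; apply: (product_star_card (@edge_init_rcons _ n)
    (@edge_last_rcons _ n) (@edge_rconsK _ n) (@vdisjoint_peel _ n)
    (@vdisjoint_irr _ n') rB); by case: bnd.
have rB2 : 2 < r <= #|'I_(n ord_max)| by rewrite r_gt2 card_ord rn.
rewrite -[n ord_max]card_ord.
exact: (product_star_unique_gt2 (@edge_init_rcons _ n) (@edge_last_rcons _ n)
  (@edge_rconsK _ n) (@vdisjoint_peel _ n) (@vdisjoint_irr _ n') rB2 bnd).
Qed.

(** * Matchings of several sizes *)

Lemma mem_KR k (n : 'I_k -> nat) (R : {fset nat}) (M : {set edge n}) :
  (M \in KR n R) = is_matching M && (#|M| \in R).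
Proof.
rewrite /KR; have -> : (#|M| \in R) = (#|M| \in (R : seq nat)) by [].
elim: (R : seq nat) => [|r s IH]; first by rewrite big_nil in_set0 andbF.
by rewrite big_cons in_setU IH !inE -andb_orr.
Qed.

Lemma mem_matchings_vdisjoint k (n : 'I_k -> nat) r (M : {set edge n}) :
  (M \in matchings (@vdisjoint _ n) r) = is_matching M && (#|M| == r).
Proof. by rewrite inE. Qed.

Lemma mem_star k (n : 'I_k -> nat) (R : {fset nat}) e (M : {set edge n}) :
  (M \in star R e) = (#|M| \in R) && (M \in mstar (@vdisjoint _ n) #|M| e).
Proof.
by rewrite in_set mem_KR mem_mstar mem_matchings_vdisjoint eqxx andbT andbAC andbC.
Qed.

Lemma card_by_size (T : finType) (R : {fset nat}) (F : {set {set T}}) :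
  (forall M, M \in F -> #|M| \in R) ->
  #|F| = \sum_(r <- R) #|[set M in F | #|M| == r]|.
Proof.
move=> FR; rewrite -sum1_card.
rewrite (eq_bigr (fun r => \sum_(M in F) (#|M| == r : nat))); last first.
  move=> r _; rewrite -sum1_card big_mkcond [RHS]big_mkcond /=.
  by apply: eq_bigr => M _; rewrite inE; case: (_ \in _); case: eqP.
rewrite exchange_big /=; apply: eq_bigr => M MF.
have := FR M MF; move: (fset_uniq R).
have -> : (#|M| \in R) = (#|M| \in (R : seq nat)) by [].
move=> uR MR; rewrite (bigD1_seq #|M|) //= eqxx big1 // => r.
by rewrite eq_sym => /negPf->.
Qed.

Section IntersectingMatchings.
Variables (k : nat) (n : 'I_k.+2 -> nat) (R : {fset nat}).
Hypotheses (n_min : forall i, n ord0 <= n i) (R_neq0 : R <> fset0).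
Hypothesis R_sub : forall r, r \in R -> 1 <= r <= n ord0.
Variable e0 : edge n.
Let d := @vdisjoint _ n.
(** All stars at one size [r] in [R] turn out equally large, so an arbitrary edge [e0] serves to
    name the bound. *)
Let s r := #|mstar d r e0|.

Lemma star_size_facts r : r \in R ->
  [/\ s r * (r.-1)`! = \prod_i (n i).-1 ^_ r.-1, 0 < s r, star_bound d r (s r) &
      star_unique d r (s r)].
Proof.
move=> rR; have /andP[r_gt0 rn] := R_sub rR.
have rni i : r <= n i by apply: leq_trans (n_min i).
have [s' [s'E bnd uniq]] := edge_star_theorem r_gt0 rni n_min.
have sE : s r = s' by case: bnd => star_s _; apply: star_s.
have : 0 < s' * (r.-1)`!.
  by rewrite s'E prodn_gt0 // => i; rewrite ffact_gt0; have := rni i; lia.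
by rewrite muln_gt0 sE => /andP[s'_gt0 _]; split.
Qed.

Section Family.
Variable F : {set {set edge n}}.
Hypotheses (F_sub : F \subset KR n R) (F_int : intersecting F).
Let Fr r := [set M in F | #|M| == r].

Lemma family_size_in_R M : M \in F -> #|M| \in R.
Proof. by move/(subsetP F_sub); rewrite mem_KR => /andP[]. Qed.

Lemma level_matchings r : Fr r \subset matchings d r.
Proof.
apply/subsetP=> M; rewrite in_set mem_matchings_vdisjoint => /andP[MF ->].
by move: (subsetP F_sub M MF); rewrite mem_KR => /andP[->].
Qed.

Lemma level_meets r : meets (Fr r).
Proof. by move=> M N; rewrite !in_set => /andP[MF _] /andP[NF _]; apply: F_int. Qed.

Lemma level_bound r : r \in R -> #|Fr r| <= s r.
Proof.
by case/star_size_facts=> _ _ [_ bnd] _; apply: bnd (level_matchings r) (@level_meets r).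
Qed.

Lemma family_bound : #|F| <= \sum_(r <- R) s r.
Proof.
rewrite (card_by_size family_size_in_R) big_seq [leqRHS]big_seq.
by apply: leq_sum => r; apply: level_bound.
Qed.

Hypothesis cF : #|F| = \sum_(r <- R) s r.

Lemma level_card r : r \in R -> #|Fr r| = s r.
Proof.
move=> rR; have : \sum_(r <- R | r \in R) (s r - #|Fr r|) = 0.
  rewrite sumnB; last by move=> r'; apply: level_bound.
  by rewrite -!big_seq -(card_by_size family_size_in_R) cF subnn.
move/eqP; rewrite sum_nat_seq_eq0 => /allP/(_ r rR); rewrite rR /= subn_eq0 => le_s.
by apply/eqP; rewrite eqn_leq le_s level_bound.
Qed.

Lemma level_star r : r \in R -> exists e, Fr r = mstar d r e.
Proof.
move=> rR; have [_ s_gt0 [star_s _] uniq] := star_size_facts rR.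
have [e eF] := uniq _ (level_matchings r) (@level_meets r) (level_card rR) s_gt0.
exists e; apply/eqP; rewrite eqEcard star_s level_card // leqnn andbT.
by apply/subsetP=> M MF; rewrite mem_mstar eF // (subsetP (level_matchings r)).
Qed.

Lemma level_nonempty r : r \in R -> exists M, M \in Fr r.
Proof.
by move=> rR; apply/card_gt0P; rewrite level_card //; case: (star_size_facts rR).
Qed.

Lemma level_sub r M : M \in Fr r -> M \in F.
Proof. by rewrite in_set => /andP[]. Qed.

(** If [1] is in [R], the edge of a single-edge member lies in all others. Otherwise every level is
    a star of matchings with at least two edges, and stars of different sizes with distinct centres
    contain disjoint matchings by [product_crossing_stars]. *)
Lemma common_edge : exists e, forall M, M \in F -> e \in M.
Proof.
have byl e : (forall r M, r \in R -> M \in Fr r -> e \in M) ->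
    forall M, M \in F -> e \in M.
  move=> eFr M MF; apply: (eFr #|M|); first exact: family_size_in_R.
  by rewrite in_set MF eqxx.
have [R1|R1] := boolP (1 \in R).
  have [M MF1] := level_nonempty R1.
  have /matchingsP[_ /eqP/cards1P[e ME]] := subsetP (level_matchings 1) M MF1.
  exists e => N NF; have [f [+ fN]] := F_int (level_sub MF1) NF.
  by rewrite ME inE => /eqP<-.
have [r0 r0R] : exists r, r \in R.
  by have [E|[r rR]] := fset_0Vmem R; [case: R_neq0|exists r].
have [e Fe] := level_star r0R; exists e; apply: byl => r M rR MFr.
have R_gt1 t : t \in R -> 1 < t.
  move=> tR; have /andP[t_gt0 _] := R_sub tR; rewrite ltn_neqAle t_gt0 andbT.
  by apply: contraNneq R1 => ->.
have [rE|r_neq] := eqVneq r r0.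
  by move: MFr; rewrite rE Fe mem_mstar => /andP[].
have [f Ff] := level_star rR.
have [ef|ef] := eqVneq f e; first by move: MFr; rewrite Ff ef mem_mstar => /andP[].
have cross u v a b : u \in R -> v \in R -> Fr u = mstar d u a -> Fr v = mstar d v b ->
    u < v -> a != b -> False.
  move=> uR vR Fu Fv uv ab.
  have star_ex w c : w \in R -> Fr w = mstar d w c ->
      exists2 N, N \in matchings d w & c \in N.
    move=> wR Fw; have [N] := level_nonempty wR; rewrite Fw mem_mstar => /andP[].
    by exists N.
  have vB : v <= #|'I_(n ord_max)|.
    by rewrite card_ord; apply: leq_trans (n_min _); case/andP: (R_sub vR).
  have [N [N' [NF N'F disj]]] := product_crossing_stars (@edge_init_rcons _ n)
    (@edge_last_rcons _ n) (@edge_rconsK _ n) (@vdisjoint_peel _ n) (@vdisjoint_irr _ _)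
    (R_gt1 u uR) uv vB ab (star_ex u a uR Fu) (star_ex v b vR Fv).
  rewrite -Fu in NF; rewrite -Fv in N'F.
  have [x [xN xN']] := F_int (level_sub NF) (level_sub N'F).
  by move/pred0P/(_ x): disj; rewrite /= xN xN'.
exfalso; move: r_neq; rewrite neq_ltn => /orP[lt|lt].
  exact: cross rR r0R Ff Fe lt ef.
by apply: cross r0R rR Fe Ff lt _; rewrite eq_sym.
Qed.

End Family.

Lemma card_star (e : edge n) : #|star R e| = \sum_(r <- R) s r.
Proof.
rewrite (@card_by_size _ R) => [|M]; last by rewrite mem_star => /andP[].
rewrite big_seq [RHS]big_seq; apply: eq_bigr => r rR.
have [_ _ [star_s _] _] := star_size_facts rR.
rewrite -(star_s e); apply: eq_card => M; rewrite in_set mem_star.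
case: (eqVneq #|M| r) => [Mr|Mr]; first by rewrite Mr rR andbT.
rewrite andbF mem_mstar mem_matchings_vdisjoint (negPf Mr) andbF.
by [].
Qed.

Lemma star_family_unique (F : {set {set edge n}}) :
  F \subset KR n R -> intersecting F ->
  (#|F| = \sum_(r <- R) s r <-> is_star R F).
Proof.
move=> F_sub F_int; split=> [cF|[e ->]]; last exact: card_star.
have [e eF] := common_edge F_sub F_int cF; exists e.
apply/eqP; rewrite eqEcard card_star cF leqnn andbT.
by apply/subsetP=> M MF; rewrite in_set eF // (subsetP F_sub).
Qed.

End IntersectingMatchings.

Theorem theorem3p1 (k : nat) (hk : 2 <= k) (n : 'I_k -> nat)
  (n1_gt0 : 1 <= n (first_part hk))
  (n_mono : forall i j : 'I_k, i <= j -> n i <= n j)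
  (R : {fset nat}) (R_neq0 : R <> fset0)
  (R_sub : forall r : nat, r \in R -> 1 <= r <= n (first_part hk))
  (F : {set {set edge n}}) (F_sub : F \subset KR n R)
  (F_int : intersecting F) :
  let bound : rat :=
    (\sum_(r <- R)
       (\prod_(i < k) ((n i).-1 ^_ r.-1)%N)%:R / ((r.-1)`!)%:R)%R in
  (#|F|%:R <= bound)%R /\ (#|F|%:R%R = bound <-> is_star R F).
Proof.
case: k hk n n1_gt0 n_mono R_sub F F_sub F_int => [|[|k]] // hk n.
have -> : first_part hk = ord0 by apply: val_inj.
move=> n_gt0 n_mono R_sub F F_sub F_int bound.
have n_min i : n ord0 <= n i by apply: n_mono.
have ni_gt0 i : 0 < n i by apply: leq_trans (n_min i).
pose e0 : edge n := [ffun i => Ordinal (ni_gt0 i)].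
(* Each quotient is the size of a star, so the rational bound is a natural number. *)
have boundE : bound = (\sum_(r <- R) #|mstar (@vdisjoint _ n) r e0|)%:R%R.
  rewrite /bound GRing.natr_sum big_seq [RHS]big_seq; apply: eq_bigr => r rR.
  have [<- _ _ _] := star_size_facts n_min R_sub e0 rR.
  rewrite GRing.natrM GRing.mulfK // Num.Theory.pnatr_eq0 -lt0n.
  exact: fact_gt0.
rewrite boundE Num.Theory.ler_nat; split; first exact: family_bound.
rewrite -(star_family_unique n_min R_neq0 R_sub e0 F_sub F_int).
by split=> [/eqP|->] //; rewrite Num.Theory.eqr_nat => /eqP.
Qed.
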